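(* Let $\mathbf{k}$ be an algebraically closed field of characteristic $0$, let $U$ be a $\mathbf{k}$-vector space of dimension $2$, let $\lambda$ be a partition of $d\geq 1$, and let $M_\lambda=\bigoplus_{m\ge 0}\mathbf{S}_\lambda(\operatorname{Sym}^m U)$. Then the equivariant Hilbert series of $M_\lambda$ is $$\mathrm{H}_{M_\lambda}(t)=\sum_{m\ge 0}s_\lambda(1,q,\dots,q^m)\,t^m=\frac{\sum_{T\in \mathrm{SYT}(\lambda)}t^{\mathrm{des}(T)}q^{\mathrm{maj}(T)}}{(1-t)(1-qt)\cdots(1-q^dt)}.$$
   Context: $\mathbf{S}_\lambda$ is the Schur functor associated with $\lambda$ ($\mathbf{S}_{(d)}=\operatorname{Sym}^d$, $\mathbf{S}_{(1^d)}=\bigwedge^d$), and $s_\lambda(x_1,\dots,x_k)$ is the Schur polynomial, i.e. the character of $\mathbf{S}_\lambda(\mathbb{C}^k)$. The module $M_\lambda$ is graded by $m$: its degree $m$ part is $(M_\lambda)_m=\mathbf{S}_\lambda(\operatorname{Sym}^m U)$, a polynomial $\mathbf{GL}(U)$-representation of degree $dm$. For a polynomial $\mathbf{GL}(U)$-representation $L$ of degree $k$ with $\dim U=2$, let $L=\bigoplus_{i+j=k}L_{i,j}$ be the weight decomposition for the maximal torus $(\mathbf{k}^* )^2$, where $(t_1,t_2)$ acts on $L_{i,j}$ by $t_1^it_2^j$. Its character is $\operatorname{ch}(L)=\sum_{i=0}^k\dim(L_{i,k-i})q^i\in\mathbb{Z}[q]$. The equivariant Hilbert series of a graded $\mathbf{GL}(U)$-equivariant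 module $M=\bigoplus_m M_m$ is $\mathrm{H}_M(t)=\sum_m \operatorname{ch}(M_m)t^m$. $\mathrm{SYT}(\lambda)$ is the set of standard Young tableaux of shape $\lambda$ (fillings of the Young diagram with $1,\dots,d$, each used once, increasing along rows and down columns; the diagram has $\lambda_i$ boxes in row $i$, with row $1$ at the top). $T\in\mathrm{SYT}(\lambda)$ has a descent at $i$ if $i+1$ appears in a lower row than $i$; $\mathrm{des}(T)$ is the number of descents of $T$ and $\mathrm{maj}(T)$ is the sum of the descents of $T$. *)

(* Defs.v *)
From HB Require Import structures.
From mathcomp Require Import all_boot all_order all_fingroup all_algebra.
From mathcomp Require Import boolp classical_sets.
From mathcomp Require Import zify.

Set Implicit Arguments.
Unset Strict Implicit.
Unset Printing Implicit Defensive.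

Import GRing.Theory.
Local Open Scope ring_scope.

(** * Formal power series in one variable, as coefficient sequences *)

Definition fps (R : Type) := nat -> R.

Section Fps.
Variable R : comUnitRingType.
Implicit Types f g : fps R.

Definition fps_one : fps R := fun n => (n == 0%N)%:R.

Definition fps_mul f g : fps R := fun n => \sum_(i < n.+1) f i * g (n - i)%N.

(* [:: g_0; ...; g_n] where g = 1/f, from f_0 g_n + f_1 g_(n-1) + ... = 0. *)
Fixpoint fps_inv_seq f n : seq R :=
  if n is n'.+1 then
    let s := fps_inv_seq f n' in
    rcons s (- (f 0%N)^-1 * \sum_(j < n) f (n - j)%N * s`_j)
  else [:: (f 0%N)^-1].

(* Meaningful when the constant coefficient f 0 is a unit. *)
Definition fps_inv f : fps R := fun n => (fps_inv_seq f n)`_n.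

Definition fps_div f g : fps R := fps_mul f (fps_inv g).

Definition fps_of_poly (p : {poly R}) : fps R := fun n => p`_n.

Lemma size_fps_inv_seq f n : size (fps_inv_seq f n) = n.+1.
Proof. by elim: n => //= n IHn; rewrite size_rcons IHn. Qed.

Lemma nth_fps_inv_seq f n j : (j <= n)%N -> (fps_inv_seq f n)`_j = fps_inv f j.
Proof.
elim: n => [|n IHn]; first by rewrite leqn0 => /eqP->.
rewrite leq_eqVlt => /predU1P[->//|le_jn].
by rewrite /= nth_rcons size_fps_inv_seq le_jn IHn.
Qed.

Lemma fps_mulV f : f 0%N \is a GRing.unit ->
  fps_mul f (fps_inv f) =1 fps_one.
Proof.
move=> f0 [|n]; rewrite /fps_mul /fps_one.
  by rewrite big_ord_recl big_ord0 addr0 /= /fps_inv /= divrr.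
rewrite big_ord_recl /= subn0 /= {1}/fps_inv /= nth_rcons size_fps_inv_seq.
rewrite ltnn eqxx !mulNr mulrN mulVKr // (reindex_inj rev_ord_inj) /=.
apply/eqP; rewrite addrC subr_eq0; apply/eqP/eq_bigr => i _.
rewrite nth_fps_inv_seq; last by rewrite subSS leq_subr.
by congr (f _ * fps_inv f _); have := ltn_ord i; rewrite /bump /=; lia.
Qed.
End Fps.

(** * Tensor powers *)

Section Tensor.
Variables (K : fieldType) (d : nat).

(* The tensor power V^{(x)d}: the value at a of a tensor is its coordinate on
   e_(a 0) (x) ... (x) e_(a (d-1)), where e is the basis vbasis {:V} of V. *)
Definition tpow (V : vectType K) : vectType K :=
  {ffun {ffun 'I_d -> 'I_(\dim {:V})} -> K^o}.

(* The pure tensor v_0 (x) ... (x) v_(d-1). *)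
Definition tens (V : vectType K) (v : {ffun 'I_d -> V}) : tpow V :=
  [ffun a : {ffun 'I_d -> 'I_(\dim {:V})} =>
     \prod_i coord (vbasis {:V}) (a i) (v i)].

Fact tpowE (V : vectType K) (c : K) (x y : tpow V) a :
  (c *: x + y) a = c * x a + y a.
Proof. by rewrite !ffunE. Qed.

Definition multilinear (V W : vectType K) (phi : {ffun 'I_d -> V} -> W) :=
  forall (v : {ffun 'I_d -> V}) (i : 'I_d),
    linear (fun x => phi [ffun j => if j == i then x else v j]).

(* The linear map tpow V -> W induced by a multilinear phi (see tlinE). *)
Definition tlin_fun (V W : vectType K) (phi : {ffun 'I_d -> V} -> W)
    (x : tpow V) : W :=
  \sum_(a : {ffun 'I_d -> 'I_(\dim {:V})})
     x a *: phi [ffun i => (vbasis {:V})`_(a i)].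

Fact tlin_fun_linear (V W : vectType K) (phi : {ffun 'I_d -> V} -> W) :
  linear (tlin_fun phi).
Proof.
move=> c x y; rewrite /tlin_fun scaler_sumr -big_split /=.
by apply: eq_bigr => a _; rewrite tpowE scalerDl scalerA.
Qed.

HB.instance Definition _ (V W : vectType K) (phi : {ffun 'I_d -> V} -> W) :=
  GRing.isLinear.Build K (tpow V) W _ (tlin_fun phi) (tlin_fun_linear phi).

Definition tlin (V W : vectType K) (phi : {ffun 'I_d -> V} -> W) :
  'Hom(tpow V, W) := linfun (tlin_fun phi).

(* f^{(x)d} *)
Definition tpow_map (V W : vectType K) (f : 'Hom(V, W)) :
  'Hom(tpow V, tpow W) := tlin (fun v => tens [ffun i => f (v i)]).

(* The right action v_0 (x) ... (x) v_(d-1) |-> v_(s 0) (x) ... (x) v_(s (d-1)). *)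
Definition tperm_act (V : vectType K) (s : 'S_d) : 'End(tpow V) :=
  tlin (fun v => tens [ffun i => v (s i)]).

Lemma multilinear_eq0 (V W : vectType K) (phi : {ffun 'I_d -> V} -> W) :
  multilinear phi ->
  (forall a : {ffun 'I_d -> 'I_(\dim {:V})},
     phi [ffun i => (vbasis {:V})`_(a i)] = 0) ->
  forall v, phi v = 0.
Proof.
move=> mphi phi0.
suff H n (v : {ffun 'I_d -> V}) :
    (forall i : 'I_d, (n <= i)%N -> exists j : 'I_(\dim {:V}), v i = (vbasis {:V})`_j) ->
    phi v = 0.
  by move=> v; apply: (H d) => i; rewrite leqNgt ltn_ord.
elim: n v => [|n IHn] v Hv.
  have /fin_all_exists[f fE] i := Hv i (leq0n i).
  rewrite -[RHS](phi0 [ffun i => f i]); congr phi.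
  by apply/ffunP => i; rewrite !ffunE fE.
have [ltnd|lednd] := ltnP n d; last first.
  by apply: IHn => i lei; have := leq_trans lednd lei; rewrite leqNgt ltn_ord.
pose i0 := Ordinal ltnd.
pose g x := phi [ffun j => if j == i0 then x else v j].
have vE : v = [ffun j => if j == i0 then v i0 else v j].
  by apply/ffunP => j; rewrite ffunE; case: eqP => [->|].
pose gL := GRing.isLinear.Build K V W _ g (mphi v i0).
pose G : {linear V -> W} := HB.pack g gL.
rewrite vE -[LHS]/(G (v i0)) (coord_vbasis (memvf (v i0))) linear_sum.
apply: big1 => j _; rewrite linearZ /=; apply/eqP; rewrite scaler_eq0; apply/orP.
right; apply/eqP; apply: IHn => i lei; rewrite ffunE.
case: eqP => [_|/eqP ne]; first by exists j.
by apply: Hv; rewrite ltn_neqAle lei andbT; apply: contraNneq ne => E; apply/eqP/val_inj.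
Qed.

Lemma tens_multilinear (V : vectType K) : multilinear (@tens V).
Proof.
move=> v i c x y; apply/ffunP => a; rewrite tpowE.
rewrite [LHS]ffunE [X in _ = _ * X + _]ffunE [X in _ = _ + X]ffunE.
rewrite !(bigD1 i isT) /= !ffunE !eqxx linearP mulrDl -mulrA.
by congr (_ * (_ * _) + _ * _); apply: eq_bigr => j /negPf ji; rewrite !ffunE ji.
Qed.

Lemma tens_vbasis (V : vectType K) (a a' : {ffun 'I_d -> 'I_(\dim {:V})}) :
  tens [ffun i => (vbasis {:V})`_(a i)] a' = (a == a')%:R.
Proof.
have fV : free (vbasis {:V}) := basis_free (vbasisP _).
rewrite ffunE; have [<-|ne] := eqVneq.
  by apply: big1 => i _; rewrite ffunE coord_free // eqxx.
have [i nei] : exists i, a i != a' i.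
  by apply/existsP; rewrite -negb_forall; apply: contraNN ne => /eqfunP/ffunP/eqP.
by rewrite (bigD1 i) //= ffunE coord_free // (negPf nei) mul0r.
Qed.

(* The universal property of the tensor power: existence ... *)
Lemma tlinE (V W : vectType K) (phi : {ffun 'I_d -> V} -> W) :
  multilinear phi -> forall v, tlin phi (tens v) = phi v.
Proof.
move=> mphi v; apply/eqP; rewrite -subr_eq0; apply/eqP; move: v.
apply: (multilinear_eq0 (phi := fun v => tlin phi (tens v) - phi v)).
  move=> v i c x y; rewrite tens_multilinear mphi linearP /=.
  by rewrite scalerBr opprD addrACA.
move=> a; apply/eqP; rewrite subr_eq0; apply/eqP.
rewrite /tlin lfunE /= /tlin_fun (bigD1 a) //= tens_vbasis eqxx scale1r.
rewrite big1 ?addr0 // => a' ne; rewrite tens_vbasis eq_sym (negPf ne).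
by rewrite scale0r.
Qed.

(* ... and uniqueness. *)
Lemma tpow_ext (V W : vectType K) (f g : 'Hom(tpow V, W)) :
  (forall v, f (tens v) = g (tens v)) -> f = g.
Proof.
move=> fg; apply/lfunP => x.
have -> : x = \sum_a x a *: tens [ffun i => (vbasis {:V})`_(a i)].
  apply/ffunP => a; rewrite sum_ffunE (bigD1 a) //= ffunE tens_vbasis eqxx.
  rewrite big1 => [|a' ne]; last by rewrite ffunE tens_vbasis (negPf ne) scaler0.
  by rewrite addr0 /GRing.scale /= mulr1.
by rewrite !linear_sum; apply: eq_bigr => a _; rewrite !linearZ /= fg.
Qed.

Lemma tpow_mapE (V W : vectType K) (f : 'Hom(V, W)) (v : {ffun 'I_d -> V}) :
  tpow_map f (tens v) = tens [ffun i => f (v i)].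
Proof.
apply: tlinE => {}v i c x y.
have E z : [ffun j => f ([ffun j => if j == i then z else v j] j)]
    = [ffun j => if j == i then f z else [ffun j => f (v j)] j].
  by apply/ffunP => j; rewrite !ffunE; case: eqP.
by rewrite !E linearP tens_multilinear.
Qed.

Lemma tperm_actE (V : vectType K) (s : 'S_d) (v : {ffun 'I_d -> V}) :
  tperm_act V s (tens v) = tens [ffun i => v (s i)].
Proof.
apply: tlinE => {}v i c x y.
have E z : [ffun j => [ffun j => if j == i then z else v j] (s j)]
    = [ffun j => if j == (s^-1)%g i then z else [ffun j => v (s j)] j].
  by apply/ffunP => j; rewrite !ffunE (canF_eq (permK s)).
by rewrite !E tens_multilinear.
Qed.
End Tensor.

(** * Partitions, tableaux and Schur polynomials *)

(* A partition is given by the list of its (positive) parts. *)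
Definition is_partition (lam : seq nat) (d : nat) : bool :=
  [&& sorted geq lam, 0%N \notin lam & sumn lam == d].

(* The boxes of the diagram of lam are numbered 0, ..., |lam| - 1 row by row
   from the top, each row from left to right. *)
Section Tableaux.
Variable lam : seq nat.
Local Notation box := 'I_(sumn lam).

Definition box_row (b : box) : nat := reshape_index lam b.
Definition box_col (b : box) : nat := reshape_offset lam b.

(* A filling of the diagram by 1, ..., |lam|, each used once, is a permutation
   T of the boxes, the box b receiving the entry (T b).+1. *)
Definition entry (T : {perm box}) (b : box) : nat := (T b).+1.

Definition is_SYT (T : {perm box}) : bool :=
  [forall b : box, forall c : box,
    ((box_row b == box_row c) && (box_col b < box_col c)%N
       ==> (entry T b < entry T c)%N) &&
    ((box_col b == box_col c) && (box_row b < box_row c)%N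
       ==> (entry T b < entry T c)%N)].

Definition is_descent (T : {perm box}) (i : nat) : bool :=
  [exists b : box, exists c : box,
    [&& entry T b == i, entry T c == i.+1 & (box_row b < box_row c)%N]].

Definition des (T : {perm box}) : nat :=
  \sum_(1 <= i < sumn lam | is_descent T i) 1.

Definition maj (T : {perm box}) : nat :=
  \sum_(1 <= i < sumn lam | is_descent T i) i.

Definition is_SSYT (k : nat) (T : {ffun box -> 'I_k}) : bool :=
  [forall b : box, forall c : box,
    ((box_row b == box_row c) && (box_col b < box_col c)%N
       ==> (T b <= T c)%N) &&
    ((box_col b == box_col c) && (box_row b < box_row c)%N
       ==> (T b < T c)%N)].

(* s_lam(x_0, ..., x_(k-1)) *)
Definition schur_poly (R : comNzRingType) (k : nat) (x : 'I_k -> R) : R :=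
  \sum_(T : {ffun box -> 'I_k} | is_SSYT T) \prod_b x (T b).

Definition row_group : {set 'S_(sumn lam)} :=
  [set s : 'S_(sumn lam) | [forall b, box_row (s b) == box_row b]].
Definition col_group : {set 'S_(sumn lam)} :=
  [set s : 'S_(sumn lam) | [forall b, box_col (s b) == box_col b]].
End Tableaux.

(** * Schur functors *)

Section SchurFunctor.
Variables (K : fieldType) (lam : seq nat).
Local Notation d := (sumn lam).

Definition row_sym (V : vectType K) : 'End(tpow d V) :=
  \sum_(s in row_group lam) tperm_act V s.
Definition col_antisym (V : vectType K) : 'End(tpow d V) :=
  \sum_(s in col_group lam) (-1) ^+ s *: tperm_act V s.

(* Right action of the Young symmetrizer c_lam = a_lam b_lam. *)
Definition young_sym (V : vectType K) : 'End(tpow d V) :=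
  (col_antisym V \o row_sym V)%VF.

(* S_lam(V), as the image of c_lam in the tensor power (K of characteristic 0);
   lam is allowed to have zero parts. *)
Definition schur_space (V : vectType K) : {vspace tpow d V} := limg (young_sym V).
Definition Schur (V : vectType K) : vectType K := subvs_of (schur_space V).

(* S_lam(f) is the restriction of f^{(x)d} (see Schur_map_val). *)
Definition Schur_map (V W : vectType K) (f : 'Hom(V, W)) :
    'Hom(Schur V, Schur W) :=
  (linfun (vsproj (schur_space W)) \o tpow_map d f
     \o linfun (@vsval _ _ (schur_space V)))%VF.

Lemma tpow_map_perm (V W : vectType K) (f : 'Hom(V, W)) (s : 'S_d) x :
  tpow_map d f (tperm_act V s x) = tperm_act W s (tpow_map d f x).
Proof.
rewrite -!comp_lfunE; congr (fun_of_lfun _ x); apply: tpow_ext => v.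
rewrite !comp_lfunE tperm_actE !tpow_mapE tperm_actE.
by congr tens; apply/ffunP => i; rewrite !ffunE.
Qed.

Lemma tpow_map_young (V W : vectType K) (f : 'Hom(V, W)) x :
  tpow_map d f (young_sym V x) = young_sym W (tpow_map d f x).
Proof.
rewrite !comp_lfunE !sum_lfunE !linear_sum /=; apply: eq_bigr => s _.
rewrite !scale_lfunE linearZ /= tpow_map_perm linear_sum; congr (_ *: tperm_act _ _ _).
by apply: eq_bigr => t _; rewrite /= tpow_map_perm.
Qed.

Lemma Schur_map_val (V W : vectType K) (f : 'Hom(V, W)) (x : Schur V) :
  vsval (Schur_map f x) = tpow_map d f (vsval x).
Proof.
have /memv_imgP[y _ xE] : vsval x \in schur_space V := subvsP x.
have fx : tpow_map d f (vsval x) \in schur_space W.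
  by rewrite xE tpow_map_young memv_img ?memvf.
rewrite /Schur_map !comp_lfunE (lfunE (@vsval _ _ (schur_space V))).
by rewrite (lfunE (vsproj (schur_space W))) /= vsprojK.
Qed.
End SchurFunctor.

Lemma tperm_actM (K : fieldType) d (V : vectType K) (s t : 'S_d) x :
  tperm_act V s (tperm_act V t x) = tperm_act V (s * t)%g x.
Proof.
rewrite -comp_lfunE; congr (fun_of_lfun _ x); apply: tpow_ext => v.
rewrite comp_lfunE !tperm_actE; congr tens; apply/ffunP => i.
by rewrite !ffunE permM.
Qed.

Lemma tperm_act1 (K : fieldType) d (V : vectType K) x :
  tperm_act V (1%g : 'S_d) x = x.
Proof.
rewrite -[RHS]id_lfunE; congr (fun_of_lfun _ x); apply: tpow_ext => v.
rewrite id_lfunE tperm_actE; congr tens; apply/ffunP => i.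
by rewrite !ffunE perm1.
Qed.

(* S_(m)(V) is the space of symmetric tensors. *)
Lemma schur_space_row (K : fieldType) (m : nat) (V : vectType K)
    (x : tpow (sumn [:: m]) V) : [pchar K] =i pred0 ->
  reflect (forall s, tperm_act V s x = x) (x \in schur_space [:: m] V).
Proof.
move=> charK.
have row0 (b : 'I_(sumn [:: m])) : box_row b = 0%N.
  by rewrite /box_row /reshape_index /=; have := ltn_ord b; rewrite /=; case: eqP => //; lia.
have rowT : row_group [:: m] = [set: _].
  by apply/setP => s; rewrite !inE; apply/forallP => b; rewrite !row0.
have colE (b : 'I_(sumn [:: m])) : box_col b = b :> nat.
  have := row0 b; rewrite /box_row /box_col /reshape_offset => ->.
  by rewrite take0 subn0.
have col1 : col_group [:: m] = [set 1%g].
  apply/setP => s; rewrite !inE; apply/forallP/eqP => [H|-> b]; last by rewrite perm1.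
  by apply/permP => b; rewrite perm1; apply: val_inj; have /eqP := H b; rewrite !colE.
have yE y : young_sym [:: m] V y = \sum_s tperm_act V s y.
  rewrite comp_lfunE /col_antisym col1 big_set1 odd_perm1 expr0 scale1r tperm_act1.
  by rewrite sum_lfunE rowT; apply: eq_bigl => s; rewrite inE.
apply: (iffP idP) => [/memv_imgP[y _ ->] s|H].
  rewrite yE linear_sum /= (reindex_inj (mulgI s^-1)%g) /=.
  by apply: eq_bigr => t _; rewrite tperm_actM mulKVg.
have n0 : #|'S_(sumn [:: m])|%:R != 0 :> K.
  have /pcharf0P-> := charK; rewrite -lt0n; apply/card_gt0P; by exists 1%g.
apply/memv_imgP; exists ((#|'S_(sumn [:: m])|%:R)^-1 *: x); rewrite ?memvf //.
rewrite yE (eq_bigr (fun=> (#|'S_(sumn [:: m])|%:R)^-1 *: x)) => [|s _].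
  by rewrite sumr_const -scaler_nat scalerA divff // scale1r.
by rewrite linearZ /= H.
Qed.

(* Sym^m = S_(m); in characteristic 0, the symmetric tensors (schur_space_row). *)
Definition Sym (K : fieldType) (m : nat) (V : vectType K) : vectType K :=
  Schur [:: m] V.
Definition Sym_map (K : fieldType) (m : nat) (V W : vectType K)
    (f : 'Hom(V, W)) : 'Hom(Sym m V, Sym m W) := Schur_map [:: m] f.

(** * Weights, characters and equivariant Hilbert series *)

Section Weights.
Variables (K : fieldType) (U : vectType K) (e : 2.-tuple U).

(* When e is a basis of U: the element (t1, t2) of the maximal torus of GL(U)
   acting diagonally in e. *)
Definition torus (t1 t2 : K) : 'End(U) :=
  linfun (fun u : U => (t1 * coord e 0 u) *: e`_0 + (t2 * coord e 1 u) *: e`_1).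

Fact torus_linear (t1 t2 : K) :
  linear (fun u : U => (t1 * coord e 0 u) *: e`_0 + (t2 * coord e 1 u) *: e`_1).
Proof.
move=> c x y; rewrite scalerDr !scalerA addrACA -!scalerDl.
by congr (_ *: _ + _ *: _); rewrite linearP /= mulrDr mulrCA.
Qed.

Section Rep.
Variables (L : vectType K) (rho : 'End(U) -> 'End(L)).

Definition weight_vector (i j : nat) (v : L) : Prop :=
  forall t1 t2 : K, t1 != 0 -> t2 != 0 ->
    rho (torus t1 t2) v = (t1 ^+ i * t2 ^+ j) *: v.

(* The subspace L_(i,j) of all weight vectors (see weight_spaceP). *)
Definition weight_space (i j : nat) : {vspace L} :=
  xget 0%VS [set W : {vspace L} | forall v, v \in W <-> weight_vector i j v].

(* The character of a representation of degree k. *)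
Definition ch (k : nat) : {poly int} :=
  \sum_(i < k.+1) (\dim (weight_space i (k - i)))%:R *: 'X^i.

Lemma weight_spaceP (i j : nat) (v : L) :
  v \in weight_space i j <-> weight_vector i j v.
Proof.
suff H : exists W : {vspace L}, forall v, v \in W <-> weight_vector i j v.
  exact: (xgetPex 0%VS H).
move=> {v}.
have w0 : weight_vector i j 0 by move=> t1 t2 _ _; rewrite !linear0.
have wP c x y : weight_vector i j x -> weight_vector i j y ->
    weight_vector i j (c *: x + y).
  move=> wx wy t1 t2 n1 n2; rewrite linearP /= wx // wy // scalerDr.
  by rewrite !scalerA mulrC.
pose P n := `[< exists W : {vspace L},
  \dim W = n /\ forall v, v \in W -> weight_vector i j v >].
have exP : exists n, P n.
  exists 0%N; apply/asboolP; exists 0%VS; split; first exact: dimv0.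
  by move=> v; rewrite memv0 => /eqP->.
have ubP n : P n -> (n <= \dim {:L})%N.
  by move=> /asboolP[W [<- _]]; rewrite dimvS ?subvf.
case: (ex_maxnP exP ubP) => n /asboolP[W [dW WP]] max.
exists W => v; split=> [|wv]; first exact: WP.
have : P (\dim (<[v]> + W)%VS).
  apply/asboolP; exists (<[v]> + W)%VS; split=> // x.
  move=> /memv_addP[y /vlineP[c ->] [z /WP wz ->]].
  exact: wP.
move=> /max; rewrite -dW => le.
have /eqP E : (W == <[v]> + W)%VS by rewrite eqEdim addvSr.
by rewrite E (subvP (addvSl _ _)) ?memv_line.
Qed.
End Rep.

(* The equivariant Hilbert series of the direct sum of the representations
   L m, L m being in degree m and polynomial of degree deg m. *)
Definition equiv_hilbert (L : nat -> vectType K)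
    (rho : forall m, 'End(U) -> 'End(L m)) (deg : nat -> nat) : fps {poly int} :=
  fun m => ch (rho m) (deg m).
End Weights.

Section Module.
Variables (K : fieldType) (U : vectType K) (lam : seq nat).

Definition M_deg (m : nat) : vectType K := Schur lam (Sym m U).

Definition M_act (m : nat) (g : 'End(U)) : 'End(M_deg m) :=
  Schur_map lam (Sym_map m g).

Definition M_hilbert (e : 2.-tuple U) : fps {poly int} :=
  equiv_hilbert e M_act (fun m => sumn lam * m)%N.
End Module.

(** * The two sides as series in t over Z[q] *)

(* s_lam(1, q, ..., q^m) *)
Definition schur_principal (lam : seq nat) : fps {poly int} :=
  fun m => schur_poly lam (fun i : 'I_m.+1 => 'X^i : {poly int}).

(* Polynomials in t over Z[q]: the outer variable is t, the inner one is q. *)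
Definition syt_numerator (lam : seq nat) : {poly {poly int}} :=
  \sum_(T : {perm 'I_(sumn lam)} | is_SYT T) ('X^(maj T))%:P * 'X^(des T).

Definition hilb_denominator (d : nat) : {poly {poly int}} :=
  \prod_(i < d.+1) (1 - ('X^i)%:P * 'X).

Lemma hilb_denominator_unit (d : nat) :
  fps_of_poly (hilb_denominator d) 0%N \is a GRing.unit.
Proof.
rewrite /fps_of_poly -horner_coef0 horner_prod big1 ?unitr1 // => i _.
by rewrite !hornerE ?mulr0 ?subr0.
Qed.

(* Main.v *)
Require Import Defs.
From mathcomp Require Import all_boot all_order all_fingroup all_algebra.
From HB Require Import structures.
From mathcomp Require Import boolp zify.

(** Everything about the representation rests on one fact, [schur_basis]: in
    characteristic 0, if [v] is a basis of [V], then the images under the Young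
    symmetrizer of the pure tensors [v_A], for [A] a semistandard filling of the
    diagram, form a basis of the Schur functor at [V]. An endomorphism that is
    diagonal in [v] is then diagonal in this basis, with the monomials of the
    Schur polynomial as eigenvalues ([Schur_map_vector]). Applied to a diagram
    with one row and to the basis [e] of [U], the fact gives a basis of [Sym^m U]
    with the weights (i, m - i), one for each i; applied once more to that basis,
    it gives a weight basis of [S_lam (Sym^m U)] in which a semistandard filling
    by 0, ..., m has as weight the sum of its entries. Since the powers of 2 are
    distinct in [K], weight spaces are spanned by the basis vectors of their
    weight, and the character is [s_lam(1, q, ..., q^m)].

    The proof of [schur_basis] reads tensors as functions on fillings. A function
    in the image of the Young symmetrizer changes by the sign under a permutation
    within columns, and satisfies Garnir relations ([garnir_relation]), because
    two boxes in one row are enough to cancel an alternating sum of row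
    symmetrized terms. These relations express its value at a filling that is not
    semistandard through values at fillings that are larger for a certain order,
    so it is determined by its values at semistandard fillings
    ([young_sym_SSYT_eq0]); this bounds the dimension from above. Conversely the
    matrix of values of the proposed basis at semistandard fillings is triangular
    with nonzero diagonal ([young_vbasis_triangular], [young_vbasis_diag]).

    The second equality is Stanley's theory of P-partitions. Reading the entries
    of a semistandard filling [A] in the order of its standardization [T] yields
    a weakly increasing word that increases strictly at the descents of [T], and
    every pair of a standard tableau and such a word arises exactly once
    ([schur_poly_words]). The generating function of the words for a fixed descent
    set is a product of geometric series: dividing by [1 - q^d t] accounts for the
    last letter ([word_gf_geom]). A strict increase at the descent i shifts the
    letters after i, which would give the power [q^(d - i)]; the exponent i of the
    major index appears when a letter x is counted with weight [q^(m - x)]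
    instead. The two countings agree because the weights of a representation do
    not depend on the order of the basis: [schur_basis] applied to the reversed
    basis of [Sym^m U] shows that the Schur polynomial takes the same value at
    [(1, ..., q^m)] and at [(q^m, ..., 1)] ([ch_schur_principal_rev]). *)

Set Implicit Arguments.
Unset Strict Implicit.
Unset Printing Implicit Defensive.

Import GRing.Theory.

(** * Boxes of the diagram and semistandard fillings *)

Section Diagram.
Variable lam : seq nat.
Local Notation box := 'I_(sumn lam).
Implicit Types b c : box.

Lemma box_inj b c : box_row b = box_row c -> box_col b = box_col c -> b = c.
Proof.
rewrite /box_row /box_col => rE cE; apply: val_inj.
by rewrite /= -(reshape_indexK lam b) -(reshape_indexK lam c) rE cE.
Qed.

Lemma box_at i j : (j < nth 0 lam i)%N ->
  exists b, box_row b = i /\ box_col b = j.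
Proof.
move=> ltj; exists (Ordinal (flatten_indexP ltj)).
by rewrite /box_row /box_col /= flatten_indexKl // flatten_indexKr.
Qed.

Lemma box_col_lt b : (box_col b < nth 0 lam (box_row b))%N.
Proof. exact: reshape_offsetP. Qed.

Hypothesis lam_sorted : sorted geq lam.

Lemma nth_part_le i j : (i <= j)%N -> (nth 0 lam j <= nth 0 lam i)%N.
Proof.
move=> leij; have [ltj|/(nth_default 0)->//] := ltnP j (size lam).
have geq_trans : transitive geq by move=> x y z /= yx xz; apply: leq_trans xz yx.
by apply: (sorted_leq_nth geq_trans leqnn 0 lam_sorted);
  rewrite ?inE // (leq_ltn_trans leij).
Qed.

(** This is where the shape being a partition enters: its diagram is closed
    under moving up and to the left. *)
Lemma box_NW c i j : (i <= box_row c)%N -> (j <= box_col c)%N ->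
  exists b, box_row b = i /\ box_col b = j.
Proof.
move=> lei lej; apply: box_at; apply: leq_ltn_trans lej _.
exact: leq_trans (box_col_lt c) (nth_part_le lei).
Qed.

Lemma is_SSYTP k (A : {ffun box -> 'I_k}) :
  reflect ((forall b c, box_row b = box_row c -> (box_col b < box_col c)%N ->
              (A b <= A c)%N) /\
           (forall b c, box_col b = box_col c -> (box_row b < box_row c)%N ->
              (A b < A c)%N))
          (is_SSYT A).
Proof.
apply: (iffP forallP) => [H|[Hr Hc] b].
  split=> b c E lt; have /forallP/(_ c)/andP[/implyP h1 /implyP h2] := H b.
    by apply: h1; rewrite E eqxx.
  by apply: h2; rewrite E eqxx.
by apply/forallP => c; apply/andP; split; apply/implyP => /andP[/eqP E lt];
  [apply: Hr | apply: Hc].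
Qed.

(** Pass through the box in the row of [b] and the column of [c]. *)
Lemma SSYT_NW k (A : {ffun box -> 'I_k}) b c : is_SSYT A ->
  (box_row b < box_row c)%N -> (box_col b <= box_col c)%N -> (A b < A c)%N.
Proof.
move=> /is_SSYTP[Hr Hc] ltr lec.
have [a [ra ca]] := box_NW (ltnW ltr) (leqnn (box_col c)).
apply: leq_ltn_trans (Hc a c ca _); last by rewrite ra.
move: lec; rewrite leq_eqVlt -ca => /orP[/eqP E|lt]; last by apply: Hr.
by rewrite (box_inj (esym ra) E).
Qed.

End Diagram.

Section WeightedSum.
Variables (D : finType).
Implicit Types (w A : D -> nat).

(** For [w] the row or the column index, this measures how far a filling is
    sorted; it is the quantity that all orders on fillings below compare. *)
Definition wsum w A := \sum_b w b * A b.

Lemma wsum_perm w A (s : {perm D}) :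
  wsum w (fun b => A (s b)) = wsum (fun b => w (s^-1 b)%g) A.
Proof.
rewrite /wsum (reindex_inj (@perm_inj _ s^-1)) /=.
by apply: eq_bigr => b _; rewrite permKV.
Qed.

(** The rearrangement inequality for one transposition. *)
Lemma wsum_swap_lt w A b c : (w b < w c)%N -> (A c < A b)%N ->
  (wsum w A < wsum w (fun x => A (tperm b c x)))%N.
Proof.
move=> ltw ltA; have nbc : c != b by apply: contraTneq ltw => ->; rewrite ltnn.
rewrite /wsum !(bigD1 b isT) /= !(bigD1 c nbc) /= tpermL tpermR.
rewrite [X in (_ < _ + (_ + X))%N](eq_bigr (fun x => w x * A x)).
  by set S := \sum_(_ | _) _; nia.
by move=> x /andP[xb xc]; rewrite tpermD // eq_sym.
Qed.

End WeightedSum.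

Section ColumnPermutations.
Variables (lam : seq nat) (k : nat).
Local Notation box := 'I_(sumn lam).
Variable A : {ffun box -> 'I_k}.
Hypothesis SA : is_SSYT A.
Local Notation Av := (fun b => nat_of_ord (A b)).

Lemma col_groupP (t : 'S_(sumn lam)) :
  reflect (forall b, box_col (t b) = box_col b) (t \in col_group lam).
Proof. by rewrite inE; apply: (iffP forallP) => H b; apply/eqP. Qed.

Lemma row_groupP (t : 'S_(sumn lam)) :
  reflect (forall b, box_row (t b) = box_row b) (t \in row_group lam).
Proof. by rewrite inE; apply: (iffP forallP) => H b; apply/eqP. Qed.

(** A column permutation without inversions is trivial: among the moved boxes
    take [b] in the topmost row; the boxes above it are fixed, so [t] sends [b]
    down and sends to [b] a box lying below it. *)
Lemma col_group_inversion (t : 'S_(sumn lam)) :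
  t \in col_group lam -> t != 1%g ->
  exists b c, [/\ box_col b = box_col c, (box_row b < box_row c)%N
    & (box_row (t c) < box_row (t b))%N].
Proof.
move=> /col_groupP tC t1.
have [b0 nb0] : exists b, t b != b.
  apply/existsP; rewrite -negb_forall; apply: contraNN t1 => /forallP H.
  by apply/eqP/permP => b; rewrite perm1; apply/eqP/H.
case: (@arg_minnP _ b0 (fun b => t b != b) (fun b => box_row b)) => // b nb minb.
have fixl x : (box_row x < box_row b)%N -> t x = x.
  by move=> lt; apply/eqP; apply: contraTT lt => /minb; rewrite -leqNgt.
exists b, (t^-1 b)%g; rewrite permKV.
have cc : box_col (t^-1 b)%g = box_col b by rewrite -[in RHS](permKV t b) tC.
split=> //; rewrite ltn_neqAle.
  apply/andP; split.
    apply/eqP => E; have E2 := box_inj E (esym cc).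
    by move: nb; rewrite {1}E2 permKV eqxx.
  rewrite leqNgt; apply/negP => lt; have := fixl _ lt; rewrite permKV => E.
  by rewrite -E ltnn in lt.
apply/andP; split.
  by apply: contraNneq nb => E; apply/eqP/box_inj => //; rewrite tC.
rewrite leqNgt; apply/negP => lt; have /perm_inj E := fixl _ lt.
by rewrite E eqxx in nb.
Qed.

(** The rearrangement inequality in the columns of a semistandard filling; the
    strictness comes from the columns having distinct entries. As long as [t] has
    an inversion, undoing it increases the sum, so that only the identity can be
    the maximum. *)
Lemma wsum_col_perm_lt (t : 'S_(sumn lam)) : t \in col_group lam -> t != 1%g ->
  (wsum (fun b => box_row (t b)) Av < wsum (@box_row lam) Av)%N.
Proof.
pose F (s : 'S_(sumn lam)) := wsum (fun b => box_row (s b)) Av.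
have C1 : (1%g : 'S_(sumn lam)) \in col_group lam.
  by apply/col_groupP => b; rewrite perm1.
have F1 : F 1%g = wsum (@box_row lam) Av.
  by apply: eq_bigr => b _; rewrite perm1.
have step s : s \in col_group lam -> s != 1%g ->
    exists2 s', s' \in col_group lam & (F s < F s')%N.
  move=> sC s1; have [b [c [cE ltr lts]]] := col_group_inversion sC s1.
  exists (tperm b c * s)%g.
    apply/col_groupP => x; rewrite permM (col_groupP _ sC).
    by case: tpermP => [->|->|//]; rewrite cE.
  have [_ /(_ _ _ cE ltr) ltA] := is_SSYTP _ SA.
  rewrite /F -[X in (_ < X)%N]/(wsum (fun x => box_row ((tperm b c * s)%g x)) Av).
  have -> : wsum (fun x => box_row ((tperm b c * s)%g x)) Av
       = wsum (fun x => box_row (s x)) (fun x => Av (tperm c b x)).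
    rewrite (wsum_perm _ Av (tperm c b)) tpermV /wsum.
    by apply: eq_bigr => x _; rewrite permM tpermC.
  exact: (@wsum_swap_lt _ (fun x => box_row (s x)) Av c b lts ltA).
case: (@arg_maxnP _ 1%g (mem (col_group lam)) F C1) => s sC maxs tC t1.
have s1 : s = 1%g.
  apply/eqP; apply: contraT => /(step s sC)[s' /maxs /= le lt].
  by have := leq_trans lt le; rewrite ltnn.
have [s' /maxs le lt] := step t tC t1.
by rewrite -F1 -s1; apply: leq_trans lt le.
Qed.

End ColumnPermutations.

(** * The combinatorics of Garnir sets *)

Section Garnir.
Variable lam : seq nat.
Local Notation box := 'I_(sumn lam).
Variables p q : box.
Hypothesis col_pq : (box_col p < box_col q)%N.

(** When a filling with increasing columns decreases from [p] to [q], two boxes of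
    one row, all entries of the column of [p] from [p] down exceed all entries of
    the column of [q] from [q] up. *)
Definition garnir_lower : {set box} :=
  [set b | (box_col b == box_col p) && (box_row p <= box_row b)%N].
Definition garnir_upper : {set box} :=
  [set b | (box_col b == box_col q) && (box_row b <= box_row q)%N].
Definition garnir_set := garnir_lower :|: garnir_upper.

(** A permutation of the Garnir set that mixes the two columns brings larger
    entries into the column further to the right. *)
Lemma wsum_garnir_lt (A : box -> nat) (g : 'S_(sumn lam)) :
  (forall b c, box_col b = box_col c -> (box_row b < box_row c)%N -> (A b < A c)%N) ->
  (A q < A p)%N -> perm_on garnir_set g -> g \notin col_group lam ->
  (wsum (@box_col lam) A < wsum (@box_col lam) (fun b => A (g b)))%N.
Proof.
move=> colA ltA gZ gC; rewrite wsum_perm; set s := (g^-1)%g.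
have sZ : perm_on garnir_set s by apply: perm_onV.
have sC : exists b, box_col (s b) != box_col b.
  apply/existsP; rewrite -negb_forall; apply: contraNN gC => /forallP H.
  apply/col_groupP => b; have /eqP := H (g b); rewrite /s permK.
  by move=> ->.
have lowA b : b \in garnir_lower -> (A p <= A b)%N.
  rewrite inE => /andP[/eqP cE]; rewrite leq_eqVlt => /orP[/eqP rE|lt].
    by rewrite (box_inj rE (esym cE)).
  by apply/ltnW/colA; rewrite // cE.
have upA b : b \in garnir_upper -> (A b < A p)%N.
  move=> H; apply: leq_ltn_trans ltA; move: H.
  rewrite inE => /andP[/eqP cE]; rewrite leq_eqVlt => /orP[/eqP rE|lt].
    by rewrite (box_inj rE cE).
  by apply/ltnW/colA; rewrite // cE.
have colE x : x \in garnir_set -> (x \in garnir_lower /\ box_col x = box_col p) \/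
     (x \in garnir_upper /\ box_col x = box_col q).
  rewrite inE => /orP[xX|xY]; [left|right]; split=> //.
    by move: xX; rewrite inE => /andP[/eqP].
  by move: xY; rewrite inE => /andP[/eqP].
(* After doubling, th separates the entries of the two columns strictly, and
   subtracting it from every entry changes no difference of sums, since s permutes
   the boxes; each box then contributes with the right sign. *)
pose th := (2 * A p - 1)%N.
have E1 : (\sum_(b : box) box_col (s b) * th = \sum_(b : box) box_col b * th)%N.
  by rewrite [RHS](reindex_inj (@perm_inj _ s)).
have le (b : box) : (box_col b * (2 * A b) + box_col (s b) * th
   <= box_col (s b) * (2 * A b) + box_col b * th ?= iff (box_col (s b) == box_col b))%N.
  apply/leqifP; case: eqVneq => [-> //|ne].
  have bZ : b \in garnir_set.
    by apply: (subsetP sZ); rewrite inE; apply: contraNneq ne => ->.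
  have sbZ : s b \in garnir_set by rewrite perm_closed.
  have [[bX cb]|[bY cb]] := colE b bZ; have [[sX cs]|[sY cs]] := colE (s b) sbZ;
    move: ne; rewrite cb cs ?eqxx // => _.
    by have := lowA b bX; rewrite /th; nia.
  by have := upA b bY; rewrite /th; nia.
suff : (\sum_(b : box) (box_col b * (2 * A b) + box_col (s b) * th)
   < \sum_(b : box) (box_col (s b) * (2 * A b) + box_col b * th))%N.
  rewrite !big_split /= E1 ltn_add2r /wsum.
  under eq_bigr do rewrite mulnCA; rewrite -big_distrr /=.
  under [X in (_ < X)%N -> _]eq_bigr do rewrite mulnCA; rewrite -big_distrr /=.
  by rewrite ltn_pmul2l.
have [b nb] := sC.
have := leqif_sum (P := xpredT) (fun b (_ : true) => le b).
move/leqifP; case: forallP => // H; have /implyP/(_ isT) := H b.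
by rewrite (negPf nb).
Qed.

Hypothesis lam_sorted : sorted geq lam.
Hypothesis row_pq : box_row p = box_row q.

(** The Garnir set has one box more than the column of [p], and the rows that
    it meets after [t] are all rows of that column. *)
Lemma garnir_pigeonhole (t : 'S_(sumn lam)) : t \in col_group lam ->
  exists x y, [/\ x \in garnir_set, y \in garnir_set, x != y &
    box_row (t x) = box_row (t y)].
Proof.
move=> /col_groupP tC.
(* The default p is never taken on the boxes considered. *)
pose at_ (i j : nat) := odflt p [pick b : box | (box_row b == i) && (box_col b == j)].
have atE (c : box) i j : (i <= box_row c)%N -> (j <= box_col c)%N ->
    box_row (at_ i j) = i /\ box_col (at_ i j) = j.
  move=> lei lej; rewrite /at_; case: pickP => [b /andP[/eqP-> /eqP->]//|no].
  have [b [rb cb]] := box_NW lam_sorted lei lej.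
  by have := no b; rewrite rb cb !eqxx.
have dXY : [disjoint garnir_lower & garnir_upper].
  apply/pred0P => b /=; rewrite !inE; apply/negbTE/negP.
  case/andP=> /andP[/eqP-> _] /andP[/eqP E _].
  by move: col_pq; rewrite E ltnn.
pose Cp := [set b : box | box_col b == box_col p].
pose L := [set b in Cp | (box_row b < box_row p)%N].
have cardC : #|Cp| = (#|garnir_lower| + #|L|)%N.
  rewrite -(cardsID garnir_lower Cp); congr (_ + _)%N; apply: eq_card => b.
    by rewrite !inE; case: eqP.
  by rewrite !inE; case: eqP => //= _; rewrite -ltnNge andbT.
have cardL : (#|L| < #|garnir_upper|)%N.
  have -> : #|L|.+1 = #|p |: L| by rewrite cardsU1 !inE ltnn andbF.
  pose f (b : box) := at_ (box_row b) (box_col q).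
  have fE (b : box) : b \in p |: L -> box_row (f b) = box_row b /\ box_col (f b) = box_col q.
    rewrite !inE => Hb; apply: (atE q) => //; rewrite -row_pq.
    by case/orP: Hb => [/eqP->//|/andP[_ /ltnW]].
  rewrite -(card_in_imset (f := f) (D := p |: L)).
    apply/subset_leq_card/subsetP => _ /imsetP[b bL ->].
    have [rE cE] := fE b bL; rewrite inE rE cE eqxx /= -row_pq.
    by move: bL; rewrite !inE => /orP[/eqP->//|/andP[_ /ltnW]].
  move=> b c bL cL E; have [rb cb] := fE b bL; have [rc cc] := fE c cL.
  have colL d : d \in p |: L -> box_col d = box_col p.
    by rewrite !inE => /orP[/eqP->//|/andP[/eqP]].
  by apply: box_inj; rewrite ?(colL b bL) ?(colL c cL) // -rb -rc E.
have cardZ : #|garnir_set| = (#|garnir_lower| + #|garnir_upper|)%N.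
  by rewrite cardsU (disjoint_setI0 dXY) cards0 subn0.
have [|inj] := boolP [exists x in garnir_set, exists y in garnir_set,
    (x != y) && (box_row (t x) == box_row (t y))].
  move=> /exists_inP[x xZ /exists_inP[y yZ /andP[xy /eqP E]]].
  by exists x, y.
pose f (x : box) := at_ (box_row (t x)) (box_col p).
have fE (x : box) : x \in garnir_set -> box_row (f x) = box_row (t x) /\ box_col (f x) = box_col p.
  move=> xZ; apply: (atE (t x)) => //; rewrite tC.
  by move: xZ; rewrite !inE => /orP[/andP[/eqP->//]|/andP[/eqP-> _]]; apply: ltnW.
have : (#|garnir_set| <= #|Cp|)%N.
  rewrite -(card_in_imset (f := f) (D := garnir_set)).
    apply/subset_leq_card/subsetP => _ /imsetP[x xZ ->].
    by rewrite inE; have [_ ->] := fE x xZ.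
  move=> x y xZ yZ E; have [rx _] := fE x xZ; have [ry _] := fE y yZ.
  apply/eqP; apply: contraNT inj => xy.
  by apply/exists_inP; exists x => //; apply/exists_inP; exists y; rewrite // xy -rx -ry E /=.
by rewrite cardZ cardC leq_add2l leqNgt cardL.
Qed.

End Garnir.

(** Within a row, the number of entries at least equal to a given value is the
    same for [A] and [B], and for a sorted row these numbers determine it. *)
Lemma row_equiv_sorted lam k (A B : {ffun 'I_(sumn lam) -> 'I_k}) (s : 'S_(sumn lam)) :
  is_SSYT A -> is_SSYT B -> s \in row_group lam ->
  (forall b, B b = A (s b)) -> A = B.
Proof.
have key (A' B' : {ffun 'I_(sumn lam) -> 'I_k}) (u : 'S_(sumn lam)) :
  is_SSYT A' -> is_SSYT B' -> u \in row_group lam ->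
  (forall b, B' b = A' (u b)) -> forall b, (B' b <= A' b)%N.
  move=> /is_SSYTP[rA _] /is_SSYTP[rB _] /row_groupP uR E b.
  rewrite leqNgt; apply/negP => lt.
  pose S (C : {ffun 'I_(sumn lam) -> 'I_k}) :=
    [set c | (box_row c == box_row b) && (B' b <= C c)%N].
  have card : #|S B'| = #|S A'|.
    have -> : S B' = u @^-1: S A' by apply/setP => c; rewrite !inE (E c) uR.
    by apply: card_preimset; apply: perm_inj.
  have : S A' \proper S B'.
    apply/properP; split; last first.
      by exists b; rewrite !inE eqxx //= -ltnNge.
    apply/subsetP => c; rewrite !inE => /andP[/eqP rE le]; rewrite rE eqxx /=.
    apply: rB => //; rewrite ltnNge leq_eqVlt; apply/negP => /orP[/eqP cE|lt'].
      by move: le; rewrite (box_inj rE cE) leqNgt lt.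
    by have := rA c b rE lt'; rewrite leqNgt (leq_trans lt le).
  by move/proper_card; rewrite card ltnn.
move=> SA SB sR E; apply/ffunP => b; apply/val_inj/eqP; rewrite eqn_leq.
rewrite (key _ _ s SA SB sR E) andbT.
apply: (key _ _ (s^-1)%g SB SA); last by move=> c; rewrite E permKV.
by apply/row_groupP => c; rewrite -[in RHS](permKV s c) (row_groupP _ sR).
Qed.

(** * The image of the Young symmetrizer, in coordinates *)

Section Coordinates.
Variables (K : fieldType) (V : vectType K).
Local Notation n := (\dim {:V}).
Local Open Scope ring_scope.

Lemma tperm_act_coord d (s : 'S_d) (x : tpow d V) (a : {ffun 'I_d -> 'I_n}) :
  tperm_act V s x a = x [ffun i => a (s^-1 i)%g].
Proof.
rewrite /tperm_act /tlin lfunE /= /tlin_fun sum_ffunE.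
have E (b : {ffun 'I_d -> 'I_n}) :
    (x b *: tens [ffun i => [ffun i0 => (vbasis {:V})`_(b i0)] (s i)]) a
    = x b * ([ffun i => b (s i)] == a)%:R.
  rewrite ffunE -tens_vbasis; congr (_ * tens _ a).
  by apply/ffunP => i; rewrite !ffunE.
under eq_bigr do rewrite E.
rewrite (bigD1 [ffun i => a (s^-1 i)%g]) //= big1 => [|b nb].
  rewrite addr0 (_ : _ == a) ?mulr1 //; apply/eqP/ffunP => i.
  by rewrite !ffunE permK.
rewrite (_ : _ == a = false) ?mulr0 //; apply: contraNF nb => /eqP<-.
by apply/eqP/ffunP => i; rewrite !ffunE permKV.
Qed.

Variable lam : seq nat.
Local Notation box := 'I_(sumn lam).
Local Notation fil := {ffun box -> 'I_n}.

Definition refill (a : fil) (s : 'S_(sumn lam)) : fil := [ffun b => a (s b)].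

Lemma refillM a s t : refill (refill a s) t = refill a (t * s)%g.
Proof. by apply/ffunP => b; rewrite !ffunE permM. Qed.

Lemma refill1 a : refill a 1%g = a.
Proof. by apply/ffunP => b; rewrite !ffunE perm1. Qed.

Lemma row_sym_coord x (a : fil) :
  row_sym lam V x a = \sum_(s in row_group lam) x (refill a s^-1%g).
Proof.
rewrite /row_sym sum_lfunE sum_ffunE; apply: eq_bigr => s _.
exact: tperm_act_coord.
Qed.

Lemma young_sym_coord x (a : fil) :
  young_sym lam V x a =
  \sum_(t in col_group lam) (-1) ^+ t * row_sym lam V x (refill a t^-1%g).
Proof.
rewrite /young_sym comp_lfunE /col_antisym sum_lfunE sum_ffunE.
apply: eq_bigr => t _; rewrite scale_lfunE ffunE.
by rewrite tperm_act_coord.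
Qed.

Lemma row_group_group_set : group_set (row_group lam).
Proof.
apply/group_setP; split=> [|s t /row_groupP sR /row_groupP tR]; apply/row_groupP => b.
  by rewrite perm1.
by rewrite permM tR sR.
Qed.
Canonical row_group_group := Group row_group_group_set.

Lemma col_group_group_set : group_set (col_group lam).
Proof.
apply/group_setP; split=> [|s t /col_groupP sR /col_groupP tR]; apply/col_groupP => b.
  by rewrite perm1.
by rewrite permM tR sR.
Qed.
Canonical col_group_group := Group col_group_group_set.

Lemma row_sym_refill x a s : s \in row_group lam ->
  row_sym lam V x (refill a s) = row_sym lam V x a.
Proof.
move=> sR; rewrite !row_sym_coord (reindex_inj (mulgI s)) /=.
apply: eq_big => [u|u _]; first by rewrite groupMl.
by rewrite refillM invMg mulgKV.
Qed.

Lemma young_sym_refill x a u : u \in col_group lam ->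
  young_sym lam V x (refill a u) = (-1) ^+ u * young_sym lam V x a.
Proof.
move=> uC; rewrite !young_sym_coord (reindex_inj (mulgI u)) /= mulr_sumr.
apply: eq_big => [t|t _]; first by rewrite groupMl.
by rewrite refillM invMg mulgKV odd_permM signr_addb mulrA.
Qed.

Hypothesis charK : [pchar K] =i pred0.

Lemma natr_neq0 m : (0 < m)%N -> m%:R != 0 :> K.
Proof. by move/pcharf0P: charK => ->; rewrite lt0n. Qed.

Lemma eq_opp_eq0 (y : K) : y = - y -> y = 0.
Proof.
move=> E; have /eqP : y *+ 2 = 0 by rewrite mulr2n {1}E addNr.
by rewrite -mulr_natr mulf_eq0 (negPf (natr_neq0 _)) // orbF => /eqP.
Qed.

(** For each column permutation [t], two boxes of [Z] end up in one row; the
    transposition that exchanges them flips the sign of [g] and leaves the row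
    symmetrization unchanged, so the terms for [t] sum to their opposite. *)
Lemma garnir_relation (Z : {set box}) x a :
  (forall t : 'S_(sumn lam), t \in col_group lam -> exists p q,
     [/\ p \in Z, q \in Z, p != q & box_row (t p) = box_row (t q)]) ->
  \sum_(g : 'S_(sumn lam) | perm_on Z g) (-1) ^+ g * young_sym lam V x (refill a g) = 0.
Proof.
move=> HZ; under eq_bigr do rewrite young_sym_coord mulr_sumr.
rewrite exchange_big /=; apply: big1 => t tC.
have tVC : (t^-1)%g \in col_group lam by rewrite groupV.
have [p [q [pZ qZ npq E]]] := HZ t tC.
apply: eq_opp_eq0; rewrite [LHS](reindex_inj (mulgI (tperm p q))) /= -sumrN.
have pqZ : perm_on Z (tperm p q).
  by apply: subset_trans (tperm_on p q) _; apply/subsetP => z /set2P[]->.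
apply: eq_big => [g|g _].
  apply/idP/idP => H; last exact: perm_onM.
  by rewrite -(mulKg (tperm p q) g) perm_onM // perm_onV.
rewrite odd_permM odd_tperm npq signr_addb expr1 !mulNr mul1r; congr (- (_ * (_ * _))).
rewrite !refillM; set s := (tperm p q ^ t)%g.
have -> : (t^-1 * (tperm p q * g) = s * (t^-1 * g))%g.
  by rewrite /s conjgE !mulgA mulgK.
rewrite -(refillM _ (t^-1 * g)%g) row_sym_refill // /s tpermJ; apply/row_groupP => b.
by case: tpermP => [->|->|].
Qed.

(** Straightening, by contradiction at a filling [a] that is maximal among those
    where the image of [x] does not vanish, for the lexicographic order of the two
    sums weighted by columns and by rows. A column of [a] out of order could be
    improved by a transposition, which only raises the sum weighted by rows, and
    equal entries in a column force the value to be 0. If the columns are strict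
    but a row decreases, all terms of a Garnir relation outside the column group
    are at larger fillings, and those inside are all equal. *)
Lemma young_sym_SSYT_eq0 x : sorted geq lam ->
  (forall a : fil, is_SSYT a -> young_sym lam V x a = 0) ->
  young_sym lam V x = 0.
Proof.
move=> lam_sorted; set y := young_sym lam V x => y0.
apply/eqP; apply: contraT => ny.
have [a0 na0] : exists a, y a != 0.
  apply/existsP; rewrite -negb_forall; apply: contraNN ny => /forallP H.
  by apply/eqP/ffunP => a; rewrite ffunE; apply/eqP/H.
pose v (a : fil) b := nat_of_ord (a b).
pose h a := wsum (@box_col lam) (v a).
pose f a := wsum (@box_row lam) (v a).
(* F bounds f, so that comparing N compares h and then f. *)
pose F := (\sum_(b : box) box_row b * n)%N.
have fF a : (f a <= F)%N.
  by apply: leq_sum => b _; apply: leq_mul => //; apply: ltnW; apply: ltn_ord.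
pose N a := (h a * F.+1 + f a)%N.
case: (@arg_maxnP _ a0 (fun a => y a != 0) N na0) => a na maxa.
have ygt a' : (N a < N a')%N -> y a' = 0.
  by move=> lt; apply/eqP; apply: contraTT lt => /maxa; rewrite -leqNgt.
case/negP: na; apply/eqP.
have colP b c : box_col b = box_col c -> tperm b c \in col_group lam.
  by move=> E; apply/col_groupP => z; case: tpermP => [->|->|].
have ytp b c : b != c -> box_col b = box_col c -> y (refill a (tperm b c)) = - y a.
  move=> nbc E; rewrite /y young_sym_refill; last exact: colP.
  by rewrite odd_tperm nbc expr1 mulN1r.
have [colA|/existsP[b /existsP[c]]] := boolP [forall b : box, forall c : box,
    ((box_col b == box_col c) && (box_row b < box_row c)%N) ==> (a b < a c)%N]; last first.
  rewrite negb_imply -leqNgt => /andP[/andP[/eqP cE rlt]].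
  have nbc : b != c by apply: contraTneq rlt => ->; rewrite ltnn.
  rewrite leq_eqVlt => /orP[/eqP/val_inj E|lt].
    apply: eq_opp_eq0; rewrite -(ytp b c nbc cE); congr (y _).
    by apply/ffunP => z; rewrite ffunE; case: tpermP => [->|->|].
  apply: oppr_inj; rewrite -(ytp b c nbc cE) oppr0; apply: ygt.
  have hE : h (refill a (tperm b c)) = h a.
    rewrite /h /v; under eq_fun do rewrite ffunE.
    rewrite (wsum_perm _ (v a)) tpermV; apply: eq_bigr => z _.
    by rewrite (col_groupP _ (colP b c cE)).
  rewrite /N hE ltn_add2l /f /v; under [X in (_ < wsum _ X)%N]eq_fun do rewrite ffunE.
  exact: (@wsum_swap_lt _ _ (v a) b c rlt lt).
have {}colA b c : box_col b = box_col c -> (box_row b < box_row c)%N -> (v a b < v a c)%N.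
  by move=> E lt; move/forallP/(_ b)/forallP/(_ c): colA; rewrite E eqxx lt.
have [SA|nS] := boolP (is_SSYT a); first exact: y0.
have [p [q [rE clt lt]]] : exists p q, [/\ box_row p = box_row q,
    (box_col p < box_col q)%N & (v a q < v a p)%N].
  move: nS; rewrite negb_forall => /existsP[p]; rewrite negb_forall => /existsP[q].
  rewrite negb_and !negb_imply => /orP[/andP[/andP[/eqP rE clt]]|].
    by rewrite -ltnNge => lt; exists p, q.
  by case/andP => /andP[/eqP cE rlt] /negP[]; apply: colA.
have /(garnir_relation (Z := garnir_set p q) x a) : forall t : 'S_(sumn lam),
  t \in col_group lam -> exists x y, [/\ x \in garnir_set p q, y \in garnir_set p q,
    x != y & box_row (t x) = box_row (t y)].
  by move=> t; apply: garnir_pigeonhole.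
rewrite (bigID (mem (col_group lam))) /= [X in _ + X]big1 => [|g /andP[gZ gC]]; last first.
  rewrite -/y ygt ?mulr0 // /N.
  have := wsum_garnir_lt clt colA lt gZ gC; rewrite -/(h a) => hlt.
  have -> : h (refill a g) = wsum (@box_col lam) (fun b => v a (g b)).
    by rewrite /h /v; under eq_fun do rewrite ffunE.
  by have := fF a; nia.
rewrite addr0 (eq_bigr (fun _ => y a)) => [|g /andP[_ gC]]; last first.
  by rewrite young_sym_refill // mulrA -expr2 sqrr_sign mul1r.
rewrite sumr_const => /eqP; rewrite -mulr_natr mulf_eq0 (negPf (natr_neq0 _)) ?orbF.
  by move/eqP.
by apply/card_gt0P; exists 1%g; rewrite unfold_in /= group1 perm_on1.
Qed.

(** The basis vectors of the Schur space that come from the basis defining the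
    coordinates of tensors. *)
Definition young_vbasis (a : fil) : tpow (sumn lam) V :=
  young_sym lam V (tens [ffun b => (vbasis {:V})`_(a b)]).

Lemma young_vbasis_coord (a a' : fil) : young_vbasis a a' =
  \sum_(t in col_group lam) \sum_(s in row_group lam)
     (-1) ^+ t * (a == refill a' (s^-1 * t^-1)%g)%:R.
Proof.
rewrite /young_vbasis young_sym_coord; apply: eq_bigr => t _.
rewrite row_sym_coord mulr_sumr; apply: eq_bigr => s _.
by rewrite refillM tens_vbasis.
Qed.

(** A nonzero value means that [a] is row equivalent to a column permutation of
    [a']. Row permutations do not change the sum weighted by rows, and nontrivial
    column permutations of a semistandard filling lower it. *)
Lemma young_vbasis_triangular (a a' : fil) : is_SSYT a -> is_SSYT a' ->
  young_vbasis a a' != 0 -> a = a' \/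
  (wsum (@box_row lam) (fun b => a b) < wsum (@box_row lam) (fun b => a' b))%N.
Proof.
move=> Sa Sa' nz.
have [t tC [s sR E]] : exists2 t, t \in col_group lam & exists2 s,
    s \in row_group lam & a = refill a' (s^-1 * t^-1)%g.
  have [/exists_inP[t tC /exists_inP[s sR /eqP E]]|H] := boolP
    [exists t in col_group lam, exists s in row_group lam, a == refill a' (s^-1 * t^-1)%g].
    by exists t => //; exists s.
  case/negP: nz; rewrite young_vbasis_coord; apply/eqP.
  apply: big1 => t tC; apply: big1 => s sR.
  rewrite (_ : _ == _ = false) ?mulr0 //; apply: contraNF H => H.
  by apply/exists_inP; exists t => //; apply/exists_inP; exists s.
have aE b : a b = a' ((s^-1 * t^-1)%g b) by rewrite E ffunE.
have [t1|nt] := eqVneq t 1%g.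
  left; apply/esym/(row_equiv_sorted (s := s^-1) Sa' Sa); first by rewrite groupV.
  by move=> b; rewrite aE t1 invg1 mulg1.
right; have := wsum_col_perm_lt Sa' tC nt; congr (_ < _)%N.
have := @wsum_perm _ (@box_row lam) (fun b => nat_of_ord (a' b)) (s^-1 * t^-1)%g.
under [X in wsum _ X = _ -> _]eq_fun do rewrite -aE.
move=> ->; apply: eq_bigr => b _; rewrite invMg !invgK permM.
by rewrite (row_groupP _ sR).
Qed.

(** Only the trivial column permutation contributes, so the value is the number
    of row permutations that fix [a], which is nonzero in [K]. *)
Lemma young_vbasis_diag (a : fil) : is_SSYT a -> young_vbasis a a != 0.
Proof.
move=> Sa; rewrite young_vbasis_coord (bigD1 1%g) ?group1 //= [X in _ + X]big1.
  rewrite addr0 odd_perm1 expr0; under eq_bigr do rewrite mul1r invg1 mulg1.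
  rewrite (bigID (fun s => a == refill a s^-1%g)) /= [X in _ + X]big1 => [|s /andP[_ /negPf->]//].
  rewrite addr0 (eq_bigr (fun _ => 1)) => [|s /andP[_ ->]//].
  rewrite sumr_const natr_neq0 //; apply/card_gt0P; exists 1%g.
  by rewrite unfold_in /= group1 invg1 refill1 eqxx.
move=> t /andP[tC nt]; apply: big1 => s sR.
rewrite (_ : _ == _ = false) ?mulr0 //; apply/negP => /eqP E.
(* A term with t nontrivial would make the sum weighted by rows smaller than itself. *)
have aE b : a b = a ((s^-1 * t^-1)%g b) by rewrite {1}E ffunE.
have := @wsum_perm _ (@box_row lam) (fun b => nat_of_ord (a b)) (s^-1 * t^-1)%g.
under [X in wsum _ X = _ -> _]eq_fun do rewrite -aE.
move=> E2; have := wsum_col_perm_lt Sa tC nt.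
rewrite [X in (_ < X)%N]E2 [X in (_ < X)%N](_ : _ = wsum (fun b => box_row (t b)) (fun b => a b)).
  by rewrite ltnn.
apply: eq_bigr => b _; rewrite invMg !invgK permM.
by rewrite (row_groupP _ sR).
Qed.

End Coordinates.

(** * Bases of Schur functors *)

Section IndexedBases.
Variables (K : fieldType) (L : vectType K).
Local Open Scope ring_scope.

(** Families indexed by an arbitrary finite type, such as the semistandard
    fillings, avoid choosing an enumeration of them. *)
Definition independent (I : finType) (u : I -> L) :=
  forall c : I -> K, \sum_i c i *: u i = 0 -> forall i, c i = 0.

Definition indexed_basis (I : finType) (u : I -> L) :=
  independent u /\ forall x, exists c : I -> K, x = \sum_i c i *: u i.

Lemma nth_enum_tuple (I : finType) (u : I -> L) j :
  [tuple u (enum_val i) | i < #|I|]`_(enum_rank j) = u j.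
Proof. by rewrite nth_mktuple enum_rankK. Qed.

Lemma independent_free (I : finType) (u : I -> L) : independent u ->
  free [tuple u (enum_val i) | i < #|I|].
Proof.
move=> indu; apply/freeP => k k0 i.
rewrite -(enum_valK i); apply: (indu (fun j => k (enum_rank j))).
rewrite -[RHS]k0 [RHS](reindex (@enum_rank I)); last exact/onW_bij/enum_rank_bij.
by apply: eq_bigr => j _; rewrite nth_enum_tuple.
Qed.

Lemma indexed_basis_tuple (I : finType) (u : I -> L) : indexed_basis u ->
  basis_of fullv [tuple u (enum_val i) | i < #|I|].
Proof.
move=> [indu spanu]; rewrite basisEfree independent_free // subvf /=.
apply: leq_trans (dim_span _); apply: dimvS; apply/subvP => x _.
have [c ->] := spanu x; apply: memv_suml => i _; apply/memvZ/memv_span.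
by apply/mapP; exists (enum_rank i); rewrite ?mem_enum // enum_rankK.
Qed.

Lemma independent_dim (I : finType) (u : I -> L) (W : {vspace L}) :
  independent u -> (forall i, u i \in W) ->
  (forall x, x \in W -> exists c : I -> K, x = \sum_i c i *: u i) ->
  \dim W = #|I|.
Proof.
move=> indu uW spanW; set X := [tuple u (enum_val i) | i < #|I|].
suff -> : W = <<X>>%VS.
  by have /eqP := independent_free indu; rewrite size_tuple.
apply/eqP; rewrite eqEsubv; apply/andP; split.
  apply/subvP => x /spanW[c ->]; apply: memv_suml => i _; apply/memvZ/memv_span.
  by apply/mapP; exists (enum_rank i); rewrite ?mem_enum // enum_rankK.
by apply/span_subvP => _ /mapP[i _ ->].
Qed.

Lemma independent_basis (I : finType) (u : I -> L) : independent u ->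
  (\dim {:L} <= #|I|)%N -> indexed_basis u.
Proof.
move=> indu dimL; split=> // x; set X := [tuple u (enum_val i) | i < #|I|].
have bX : basis_of fullv X.
  by rewrite basisEfree independent_free // subvf size_tuple.
exists (fun i => coord X (enum_rank i) x); rewrite {1}(coord_basis bX (memvf x)).
rewrite (reindex (@enum_rank I)); last exact/onW_bij/enum_rank_bij.
by apply: eq_bigr => j _; rewrite nth_enum_tuple.
Qed.

Lemma indexed_basis_reindex (I J : finType) (u : I -> L) (h : J -> I) :
  bijective h -> indexed_basis u -> indexed_basis (u \o h).
Proof.
move=> bh [indu spanu]; split=> [c c0 j|x]; last first.
  have [c ->] := spanu x; exists (c \o h).
  by rewrite (reindex h) //; apply: onW_bij.
have [g hK gK] := bh.
rewrite -(hK j); apply: (indu (fun i => c (g i))); rewrite -[RHS]c0.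
rewrite (reindex h) /=; last exact: onW_bij.
by apply: eq_bigr => k _; rewrite hK.
Qed.

(** In a relation, the form [phi j] isolates the coefficient of [u j] when [j] has
    the least [N] among the indices with a nonzero coefficient. *)
Lemma triangular_independent (I : finType) (u : I -> L) (phi : I -> L -> K)
    (N : I -> nat) :
  (forall i, linear (phi i : L -> K^o)) -> (forall i, phi i (u i) != 0) ->
  (forall i j, phi j (u i) != 0 -> i = j \/ (N i < N j)%N) -> independent u.
Proof.
move=> linphi diag tri c c0 i; apply/eqP; apply: contraT => nci.
case: (@arg_minnP _ i (fun i => c i != 0) N nci) => j ncj minj.
pose plin := GRing.isLinear.Build K L K^o _ (phi j) (linphi j).
pose P : {linear L -> K^o} := HB.pack (phi j : L -> K^o) plin.
have phiZ a x : phi j (a *: x) = a * phi j x by rewrite -[LHS]/(P _) linearZ.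
have : P (\sum_i c i *: u i) = 0 by rewrite c0 linear0.
rewrite linear_sum (bigD1 j) //= big1 => [|k nkj].
  rewrite addr0 phiZ => /eqP; rewrite mulf_eq0 (negPf ncj).
  by rewrite (negPf (diag j)).
rewrite phiZ; have [->|nck] := eqVneq (c k) 0; first exact: mul0r.
have [->|/(tri k j)[E|lt]] := eqVneq (phi j (u k)) 0; first exact: mulr0.
  by rewrite E eqxx in nkj.
by have := minj k nck; rewrite leqNgt lt.
Qed.

End IndexedBases.

Section SchurBasis.
Variables (K : fieldType) (charK : [pchar K]%R =i pred0).
Variables (lam : seq nat) (lam_sorted : sorted geq lam).
Local Open Scope ring_scope.

Definition ssyt (n : nat) : finType :=
  {a : {ffun 'I_(sumn lam) -> 'I_n} | is_SSYT a}.

Lemma young_vbasis_independent (V : vectType K) :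
  independent (fun a : ssyt (\dim {:V}) => young_vbasis (val a)).
Proof.
apply: (@triangular_independent _ (tpow (sumn lam) V) (ssyt (\dim {:V})) _
   (fun a x => x (val a)) (fun a => wsum (@box_row lam) (fun b => val a b))).
- by move=> a c x y; rewrite tpowE.
- by move=> a; apply: young_vbasis_diag (valP a).
- move=> a b /(young_vbasis_triangular (valP a) (valP b))[E|]; last by right.
  by left; apply: val_inj.
Qed.

(** By straightening, restriction to semistandard fillings is injective on the
    Schur space. *)
Lemma schur_dim_le (V : vectType K) :
  (\dim (schur_space lam V) <= #|ssyt (\dim {:V})|)%N.
Proof.
pose R := {ffun ssyt (\dim {:V}) -> K^o}.
pose r (x : tpow (sumn lam) V) : R := [ffun a : ssyt (\dim {:V}) => x (val a)].
have rlin : linear r by move=> c x y; apply/ffunP => a; rewrite !ffunE.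
pose rL := GRing.isLinear.Build K (tpow (sumn lam) V) R _ r rlin.
pose rr : {linear tpow (sumn lam) V -> R} := HB.pack r rL.
have rE x : linfun rr x = r x by rewrite lfunE.
rewrite -(@limg_dim_eq _ _ _ (linfun rr)); last first.
  apply/eqP; rewrite -subv0; apply/subvP => y; rewrite memv_cap memv_ker memv0.
  case/andP=> /memv_imgP[x _ ->] /eqP/ffunP y0; apply/eqP.
  apply: young_sym_SSYT_eq0 => // a Sa.
  by have := y0 (Sub a Sa); rewrite rE !ffunE.
by apply: leq_trans (dimvS (subvf _)) _; rewrite dimvf /dim /= muln1.
Qed.

Definition schur_vector (V : vectType K) n (v : 'I_n -> V)
    (a : {ffun 'I_(sumn lam) -> 'I_n}) : Defs.Schur lam V :=
  vsproj (schur_space lam V) (young_sym lam V (tens [ffun b => v (a b)])).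

Lemma schur_vector_val (V : vectType K) n (v : 'I_n -> V) a :
  vsval (schur_vector v a) = young_sym lam V (tens [ffun b => v (a b)]).
Proof. by rewrite vsprojK // memv_img ?memvf. Qed.

(** The change of basis [g] from [v] to the basis of coordinates carries the
    family to the one known to be independent, by functoriality; the dimension
    bound gives the rest. *)
Lemma schur_basis (V : vectType K) n (v : 'I_n -> V) : indexed_basis v ->
  indexed_basis (fun a : ssyt n => schur_vector v (val a)).
Proof.
move=> bv; have bX := indexed_basis_tuple bv.
pose X := [tuple v (enum_val i) | i < #|'I_n|]; rewrite -/X in bX.
have En : n = \dim {:V} by rewrite (size_basis bX) card_ord.
subst n.
apply: independent_basis; last first.
  by rewrite dimvf /dim /=; apply: schur_dim_le.
pose g (x : V) := \sum_(i < \dim {:V}) coord X (enum_rank i) x *: (vbasis {:V})`_i.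
have glin : linear g.
  move=> c x y; rewrite /g scaler_sumr -big_split; apply: eq_bigr => i _.
  by rewrite linearP scalerDl scalerA.
pose gL := GRing.isLinear.Build K V V _ g glin.
pose gg : {linear V -> V} := HB.pack g gL.
have gv i : linfun gg (v i) = (vbasis {:V})`_i.
  rewrite lfunE /= /g (bigD1 i) //= big1 => [|j nji].
    rewrite addr0 (_ : v i = X`_(enum_rank i)) ?coord_free ?(basis_free bX) //.
      by rewrite eqxx scale1r.
    by rewrite nth_enum_tuple.
  rewrite (_ : v i = X`_(enum_rank i)) ?coord_free ?(basis_free bX) //.
    by rewrite (inj_eq enum_rank_inj) eq_sym (negPf nji) scale0r.
  by rewrite nth_enum_tuple.
move=> c c0; apply: young_vbasis_independent.
have := congr1 (fun x => tpow_map (sumn lam) (linfun gg) (vsval x)) c0.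
rewrite !linear0 !linear_sum /= => {2}<-; apply: eq_bigr => a _.
rewrite !linearZ /= schur_vector_val tpow_map_young tpow_mapE.
by congr (_ *: young_sym _ _ (tens _)); apply/ffunP => b; rewrite !ffunE gv.
Qed.

Lemma Schur_map_vector (V : vectType K) n (v : 'I_n -> V) (f : 'End(V))
    (chi : 'I_n -> K) (a : {ffun 'I_(sumn lam) -> 'I_n}) :
  (forall i, f (v i) = chi i *: v i) ->
  Schur_map lam f (schur_vector v a) = (\prod_b chi (a b)) *: schur_vector v a.
Proof.
move=> fv; apply: val_inj => /=; rewrite -[LHS]/(vsval _).
rewrite Schur_map_val !schur_vector_val tpow_map_young -linearZ /=.
congr (young_sym _ _ _); rewrite tpow_mapE.
apply/ffunP => x; rewrite [LHS]ffunE [RHS]ffunE [in RHS]ffunE.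
by rewrite -[RHS]big_split /=; apply: eq_bigr => b _; rewrite !ffunE fv linearZ.
Qed.

End SchurBasis.

(** * Weights and characters *)

Section Characters.
Variables (K : fieldType) (charK : [pchar K]%R =i pred0).
Local Open Scope ring_scope.

Lemma sum_sig (V : nmodType) (I : finType) (P : pred I) (F : I -> V) :
  \sum_(s : {i | P i}) F (val s) = \sum_(i | P i) F i.
Proof.
rewrite [LHS](partition_big (fun s : {i | P i} => val s) P) /=; last first.
  by move=> s _; apply: valP.
by apply: eq_bigr => i Pi; rewrite (big_pred1 (Sub i Pi)).
Qed.

(** Extend the coefficients by 0. *)
Lemma independent_sub (L : vectType K) (I : finType) (u : I -> L) (P : pred I) :
  independent u -> independent (fun s : {i | P i} => u (val s)).
Proof.
move=> indu c c0 s.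
pose c' i := \sum_(s : {i | P i} | val s == i) c s.
have <- : c' (val s) = c s.
  by rewrite /c' (big_pred1 s) // => s'; rewrite -val_eqE.
apply: indu; rewrite -[RHS]c0 [RHS](partition_big (fun s : {i | P i} => val s) xpredT) //=.
by apply: eq_bigr => i _; rewrite /c' scaler_suml; apply: eq_bigr => s' /eqP->.
Qed.

Lemma pow2_inj i j : 2%:R ^+ i = 2%:R ^+ j :> K -> i = j.
Proof.
rewrite -!natrX; wlog le : i j / (i <= j)%N.
  by case: (leqP i j) => [le /(_ _ _ le)//|/ltnW le H /esym E]; apply/esym/(H _ _ le).
move=> /eqP; rewrite eq_sym -subr_eq0 -natrB ?leq_pexp2l //.
have /pcharf0P-> := charK; rewrite subn_eq0 leq_exp2l // => le'.
by apply/eqP; rewrite eqn_leq le le'.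
Qed.

Variables (U : vectType K) (e : 2.-tuple U).

(** The torus element (2, 1) already separates the weights, because the powers
    of 2 are distinct in characteristic 0. *)
Lemma ch_indexed_basis (L : vectType K) (rho : 'End(U) -> 'End(L)) (k : nat)
    (I : finType) (y : I -> L) (w : I -> nat) :
  indexed_basis y -> (forall i, (w i <= k)%N) ->
  (forall t1 t2 i, t1 != 0 -> t2 != 0 ->
     rho (torus e t1 t2) (y i) = (t1 ^+ w i * t2 ^+ (k - w i)) *: y i) ->
  ch e rho k = \sum_i 'X^(w i).
Proof.
move=> [indy spany] wk yw.
have dimW (j : 'I_k.+1) : \dim (weight_space e rho j (k - j)) = #|[pred i | w i == j]|.
  rewrite (@independent_dim _ _ {i | w i == j} (fun s => y (val s))) ?card_sig //.
  - exact: independent_sub.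
  - by move=> [i /= /eqP wi]; apply/weight_spaceP => t1 t2 n1 n2; rewrite yw // wi.
  - move=> x /weight_spaceP wx; have [c xE] := spany x; exists (fun s => c (val s)).
    rewrite (@sum_sig L I (fun i => w i == j) (fun i => c i *: y i)) {1}xE.
    rewrite (bigID (fun i => w i == j)) /= [X in _ + X]big1 ?addr0 // => i nwi.
    suff -> : c i = 0 by rewrite scale0r.
    have n2 : 2%:R != 0 :> K by have /pcharf0P-> := charK.
    have : \sum_i (c i * (2%:R ^+ w i - 2%:R ^+ j)) *: y i = 0.
      rewrite -[RHS](subrr (rho (torus e 2%:R 1) x)) [X in _ - X](wx _ _ n2 (oner_neq0 _)).
      rewrite {1}xE linear_sum /= {1}xE scaler_sumr -sumrB; apply: eq_bigr => i' _.
      rewrite linearZ /= yw ?oner_neq0 // !expr1n !mulr1 !scalerA -scalerBl.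
      by rewrite mulrBr [c i' * 2%:R ^+ j]mulrC.
    move/indy/(_ i)/eqP; rewrite mulf_eq0 => /orP[/eqP//|].
    by rewrite subr_eq0 => /eqP/pow2_inj E2; rewrite E2 eqxx in nwi.
rewrite /ch (partition_big (fun i => inord (w i) : 'I_k.+1) xpredT) //=.
apply: eq_bigr => j _; rewrite dimW.
rewrite (eq_bigr (fun _ => 'X^j)) => [|i /eqP <-]; last by rewrite inordK // ltnS.
rewrite sumr_const scaler_nat; congr (_ *+ _); apply: eq_card => i.
by rewrite inE [RHS]unfold_in /= inordK // ltnS.
Qed.

Lemma prod_exp_weight n m (t1 t2 : K) (a : 'I_n -> nat) : (forall b, (a b <= m)%N) ->
  \prod_b (t1 ^+ a b * t2 ^+ (m - a b)) =
  t1 ^+ (\sum_b a b) * t2 ^+ (n * m - \sum_b a b).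
Proof.
move=> am; rewrite big_split /= !prodrXr; congr (_ * _ ^+ _).
by rewrite sumnB // sum_nat_const card_ord.
Qed.

Lemma prod_step n i (t1 t2 : K) : (i <= n)%N ->
  \prod_(b < n) (if (b < i)%N then t1 else t2) = t1 ^+ i * t2 ^+ (n - i).
Proof.
move=> le; rewrite -(big_mkord xpredT (fun b => if (b < i)%N then t1 else t2)).
rewrite (big_cat_nat (leq0n i) le) /=; congr (_ * _).
  rewrite (eq_big_nat _ _ (F2 := fun _ => t1)) => [|b /andP[_ ->]//].
  by rewrite prodr_const_nat subn0.
rewrite (eq_big_nat _ _ (F2 := fun _ => t2)) => [|b /andP[leb _]]; last by rewrite ltnNge leb.
by rewrite prodr_const_nat.
Qed.

Hypothesis basis_e : basis_of fullv e.

Let e_ (i : 'I_2) : U := e`_i.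

Lemma torus_basis : indexed_basis e_.
Proof.
split=> [c c0|x]; first exact: (freeP (basis_free basis_e)).
by exists (fun i => coord e i x); apply: (coord_basis basis_e); rewrite memvf.
Qed.

Lemma torusE t1 t2 i : torus e t1 t2 (e_ i) = (if i == 0 then t1 else t2) *: e_ i.
Proof.
pose f u : U := (t1 * coord e 0 u) *: e`_0 + (t2 * coord e 1 u) *: e`_1.
pose fL := GRing.isLinear.Build K U U _ f (torus_linear e t1 t2).
pose ff : {linear U -> U} := HB.pack f fL.
rewrite /torus -[X in linfun X]/(ff : U -> U) lfunE /= /f /e_.
rewrite !coord_free ?(basis_free basis_e) //.
case: i => [[|[|]]] //= ltk; rewrite ?mulr1 ?mulr0 ?scale0r ?addr0 ?add0r //.
Qed.

Variable m : nat.

Lemma one_row_rowE (b : 'I_(sumn [:: m])) : box_row b = 0%N.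
Proof.
by rewrite /box_row /reshape_index /=; have := ltn_ord b; rewrite /=; case: eqP => //; lia.
Qed.

Lemma one_row_ltn (b : 'I_(sumn [:: m])) : (b < m)%N.
Proof. by rewrite -[X in (_ < X)%N]addn0; apply: ltn_ord. Qed.

Lemma one_row_colE (b : 'I_(sumn [:: m])) : box_col b = b.
Proof.
by have := one_row_rowE b; rewrite /box_row /box_col /reshape_offset => ->; rewrite take0 subn0.
Qed.

(** These are all the semistandard fillings of one row by two letters, indexed by
    the exponent of the first coordinate of the torus. *)
Definition step_word (i : 'I_m.+1) : {ffun 'I_(sumn [:: m]) -> 'I_2} :=
  [ffun b : 'I_(sumn [:: m]) => if (b < i)%N then ord0 else ord_max].

Lemma step_word_SSYT i : is_SSYT (step_word i).
Proof.
apply/is_SSYTP; split=> b c; rewrite ?one_row_rowE ?one_row_colE // => _ lt.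
by rewrite !ffunE; case: ltnP => // leib; rewrite ltnNge (leq_trans leib (ltnW lt)).
Qed.

Lemma step_word_inj : injective step_word.
Proof.
move=> i j /ffunP E; apply: val_inj => /=; apply/eqP.
rewrite eqn_leq; wlog le : i j E / (i <= j)%N.
  move=> H; case/orP: (leq_total i j) => le; first exact: H.
  by rewrite andbC; apply: (H j i) => // b; rewrite E.
rewrite le /= leqNgt; apply/negP => lt.
have lti : (i < sumn [:: m])%N by rewrite /= addn0 (leq_trans lt) // -ltnS ltn_ord.
by have := E (Ordinal lti); rewrite !ffunE /= ltnn lt.
Qed.

Lemma step_word_surj (a : {ffun 'I_(sumn [:: m]) -> 'I_2}) : is_SSYT a ->
  exists i, step_word i = a.
Proof.
move=> /is_SSYTP[ra _].
pose P i := [forall b : 'I_(sumn [:: m]), (i <= b)%N ==> (a b == ord_max)].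
have exP : exists i, P i.
  exists m; apply/forallP => b; apply/implyP.
  by rewrite leqNgt one_row_ltn.
case: (ex_minnP exP) => i Pi mini.
have lei : (i < m.+1)%N.
  rewrite ltnS; apply: mini; apply/forallP => b; apply/implyP.
  by rewrite leqNgt one_row_ltn.
exists (Ordinal lei); apply/ffunP => b; rewrite ffunE /=.
case: ltnP => [ltb|leb]; last by have /forallP/(_ b) := Pi; rewrite leb => /eqP->.
apply/val_inj => /=; case E: (val (a b)) (ltn_ord (a b)) => [|[|]] //= _.
have /mini : P b; last by rewrite leqNgt ltb.
apply/forallP => c; apply/implyP; rewrite leq_eqVlt => /orP[/eqP/val_inj<-|lt].
  by apply/eqP/val_inj.
apply/eqP/val_inj/eqP; rewrite eqn_leq -ltnS ltn_ord /=.
apply: leq_trans (ra b c _ _); rewrite ?one_row_rowE ?one_row_colE //.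
by rewrite -[X in (_ <= X)%N]/(val (a b)) E.
Qed.

Definition sym_vector (i : 'I_m.+1) : Defs.Sym m U :=
  schur_vector (lam := [:: m]) e_ (step_word i).

Lemma sym_basis : indexed_basis sym_vector.
Proof.
pose h i : ssyt [:: m] 2 := Sub (step_word i) (step_word_SSYT i).
have hinj : injective h by move=> i j /(congr1 val)/step_word_inj.
have surj (a : ssyt [:: m] 2) : exists i, h i = a.
  by have [i E] := step_word_surj (valP a); exists i; apply: val_inj.
have bh : bijective h.
  (* A right inverse of an injection is also a left inverse. *)
  have [g gK] := fin_all_exists surj.
  by exists g => // i; apply: hinj; rewrite gK.
exact: (indexed_basis_reindex bh (schur_basis charK (isT : sorted geq [:: m]) torus_basis)).
Qed.

Lemma Sym_map_torus t1 t2 i : Sym_map m (torus e t1 t2) (sym_vector i) =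
  (t1 ^+ i * t2 ^+ (m - i)) *: sym_vector i.
Proof.
rewrite /Sym_map /sym_vector (Schur_map_vector _ (torusE t1 t2)).
congr (_ *: _).
under eq_bigr => b _ do rewrite ffunE (fun_if (fun j : 'I_2 => if j == 0 then t1 else t2)) /=.
have le : (i <= sumn [:: m])%N by rewrite /= addn0 -ltnS.
by rewrite (prod_step _ _ le) /= addn0.
Qed.

End Characters.

Section HilbertSeries.
Variables (K : fieldType) (charK : [pchar K]%R =i pred0).
Variables (U : vectType K) (e : 2.-tuple U) (basis_e : basis_of fullv e).
Variables (lam : seq nat) (lam_sorted : sorted geq lam) (m : nat).
Local Open Scope ring_scope.

(** The basis and its weights are left free so that the basis of [Sym^m U] can
    be used in both orders. *)
Lemma ch_M_deg n (v : 'I_n -> Defs.Sym m U) (a : 'I_n -> nat) :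
  indexed_basis v -> (forall i, (a i <= m)%N) ->
  (forall t1 t2 i, Sym_map m (torus e t1 t2) (v i) =
     (t1 ^+ a i * t2 ^+ (m - a i)) *: v i) ->
  ch e (M_act lam m) (sumn lam * m) = schur_poly lam (fun i => 'X^(a i) : {poly int}).
Proof.
move=> bv am vw.
have basT := schur_basis charK lam_sorted bv.
rewrite (ch_indexed_basis charK (w := fun T : ssyt lam n => (\sum_b a (val T b))%N) basT).
- rewrite (sum_sig _ (fun T : {ffun 'I_(sumn lam) -> 'I_n} => 'X^(\sum_b a (T b)))) /schur_poly.
  by apply: eq_bigr => T _; rewrite prodrXr.
- move=> T; rewrite -[X in (_ <= X * _)%N]card_ord -sum_nat_const.
  by apply: leq_sum => b _; apply: am.
move=> t1 t2 T _ _; rewrite (Schur_map_vector _ (vw t1 t2)).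
by rewrite prod_exp_weight.
Qed.

Lemma ch_schur_principal : ch e (M_act lam m) (sumn lam * m) = schur_principal lam m.
Proof.
apply: (@ch_M_deg _ _ (fun i : 'I_m.+1 => i : nat) (sym_basis charK basis_e m)).
  by move=> i; rewrite -ltnS.
exact: Sym_map_torus.
Qed.

(** Reading the basis of [Sym^m U] backwards evaluates the Schur polynomial at the
    powers of [q] in decreasing order, and cannot change the character. *)
Lemma ch_schur_principal_rev : ch e (M_act lam m) (sumn lam * m) =
  schur_poly lam (fun i : 'I_m.+1 => 'X^(m - i) : {poly int}).
Proof.
have brev : bijective (@rev_ord m.+1) by exists (@rev_ord m.+1); apply: rev_ordK.
apply: (@ch_M_deg _ _ (fun i : 'I_m.+1 => (m - i)%N)
   (indexed_basis_reindex brev (sym_basis charK basis_e m))).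
  by move=> i; apply: leq_subr.
by move=> t1 t2 i; rewrite /= Sym_map_torus //= subSS.
Qed.

End HilbertSeries.

(** * Formal power series and their quotients *)

Section FpsTheory.
Variable R : comUnitRingType.
Local Open Scope ring_scope.
Implicit Types (f g h : fps R) (p q : {poly R}).

(** The coefficients up to degree [n] of a product only involve truncations, so
    the ring laws of series follow from those of polynomials. *)
Lemma fps_mul_trunc n f g i : (i <= n)%N ->
  fps_mul f g i = ((\poly_(j < n.+1) f j) * (\poly_(j < n.+1) g j))`_i.
Proof.
move=> lein; rewrite coefM; apply: eq_bigr => j _; rewrite !coef_poly.
by have := ltn_ord j; rewrite !ltnS => leji; rewrite (leq_trans leji lein) (leq_trans (leq_subr _ _) lein).
Qed.

Lemma fps_mulA f g h : fps_mul f (fps_mul g h) = fps_mul (fps_mul f g) h.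
Proof.
apply/funext => n; transitivity ((\poly_(j < n.+1) f j * (\poly_(j < n.+1) g j)
     * (\poly_(j < n.+1) h j))`_n).
  rewrite -mulrA coefM; apply: eq_bigr => i _.
  by rewrite (fps_mul_trunc _ _ (leq_subr i n)) coef_poly ltn_ord.
rewrite coefM; apply: eq_bigr => i _.
have lei : (i <= n)%N by rewrite -ltnS.
by rewrite (fps_mul_trunc _ _ lei) coef_poly ltnS leq_subr.
Qed.

Lemma fps_of_polyM p q : fps_mul (fps_of_poly p) (fps_of_poly q) = fps_of_poly (p * q).
Proof. by apply/funext => n; rewrite /fps_of_poly coefM. Qed.

Lemma fps_mulr1 f : fps_mul f (@fps_one R) = f.
Proof.
apply/funext => n; rewrite /fps_mul /fps_one big_ord_recr /= subnn mulr1.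
rewrite big1 ?add0r // => i _.
by rewrite subn_eq0 leqNgt ltn_ord mulr0.
Qed.

Lemma fps_div_eq f g h : h 0%N \is a GRing.unit -> fps_mul f h = g -> f = fps_div g h.
Proof.
move=> hu <-; rewrite /fps_div -fps_mulA (_ : fps_mul h _ = @fps_one R) ?fps_mulr1 //.
exact/funext/fps_mulV.
Qed.

Lemma fps_mul_polyXn f c n :
  fps_mul f (fps_of_poly (c%:P * 'X)) n = if n is n'.+1 then c * f n' else 0.
Proof.
rewrite /fps_mul /fps_of_poly; under eq_bigr do rewrite coefCM coefX.
case: n => [|n]; first by rewrite big_ord1 /= !mulr0.
rewrite !big_ord_recr /= subnn subSnn !mulr0 mulr1 addr0 big1 ?add0r 1?mulrC // => i _.
rewrite (_ : _ == _ = false) ?mulr0 //.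
by have := ltn_ord i; lia.
Qed.

Lemma fps_mul_geom f c n :
  fps_mul f (fps_of_poly (1 - c%:P * 'X)) n = f n - (if n is n'.+1 then c * f n' else 0).
Proof.
rewrite -fps_mul_polyXn -[in f n](fps_mulr1 f) /fps_mul -sumrB; apply: eq_bigr => i _.
by rewrite /fps_of_poly coefB coef1 mulrBr.
Qed.

End FpsTheory.

(** * Words with prescribed strict increases *)

Section Words.
Variables (D : pred nat) (D0 : ~~ D 0).
Local Open Scope ring_scope.

(** The letters have indices from 0, so the increase between the letters i and
    i.+1 is the descent number i.+1 of [D]. All pairs i < j are compared, not only
    adjacent ones, so that a bound on the last letter bounds every letter. *)
Definition compatible d N (f : {ffun 'I_d -> 'I_N}) : bool :=
  [forall i : 'I_d, forall j : 'I_d, (i < j)%N ==>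
     (f i <= f j)%N && ((j == i.+1 :> nat) && D j ==> (f i < f j)%N)].

Lemma compatibleP d N (f : {ffun 'I_d -> 'I_N}) :
  reflect ((forall i j : 'I_d, (i < j)%N -> (f i <= f j)%N) /\
           (forall i j : 'I_d, j = i.+1 :> nat -> D j -> (f i < f j)%N))
          (compatible f).
Proof.
apply: (iffP forallP) => [H|[Hw Hs] i].
  split=> i j lt; have /forallP/(_ j) := H i; first by rewrite lt => /andP[].
  by rewrite lt ltnS leqnn eqxx /= => /andP[_ /implyP].
apply/forallP => j; apply/implyP => lt; rewrite Hw //=.
by apply/implyP => /andP[/eqP]; apply: Hs.
Qed.

(** Words of length [d] in 0, ..., m, a letter y being counted as [q^(m - y)],
    sorted by their last letter x. The earlier letters form a word in 0, ..., x, or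
    in 0, ..., x - 1 when a strict increase is required; each letter counted
    relative to the smaller bound loses a factor, which gives the powers of [q]. *)
Fixpoint word_gf d : fps {poly int} :=
  if d is d'.+1 then fun m => \sum_(x < m.+1) 'X^(d * (m - x)) *
    (if D d' then (if nat_of_ord x is x'.+1 then 'X^d' * word_gf d' x' else 0)
     else word_gf d' x)
  else fun _ => 1.

Definition snoc d N (p : {ffun 'I_d -> 'I_N} * 'I_N) : {ffun 'I_d.+1 -> 'I_N} :=
  [ffun i => if unlift ord_max i is Some j then p.1 j else p.2].

Lemma snoc_bij d N : bijective (@snoc d N).
Proof.
exists (fun f : {ffun 'I_d.+1 -> 'I_N} => ([ffun j : 'I_d => f (lift ord_max j)], f ord_max)) => [[g x]|f].
  rewrite /snoc ffunE unlift_none; congr (_, _); apply/ffunP => j.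
  by rewrite !ffunE liftK.
apply/ffunP => i; rewrite ffunE; case: unliftP => [j ->|->] //=.
by rewrite ffunE.
Qed.

Lemma compatible_snoc d N (g : {ffun 'I_d -> 'I_N}) x :
  compatible (snoc (g, x)) =
  compatible g && [forall i : 'I_d, if D d then (g i < x)%N else (g i <= x)%N].
Proof.
have sl j : snoc (g, x) (lift ord_max j) = g j by rewrite ffunE liftK.
have sm : snoc (g, x) ord_max = x by rewrite ffunE unlift_none.
have ll (j : 'I_d) : lift ord_max j = j :> nat by rewrite /= /bump leqNgt ltn_ord.
apply/compatibleP/andP => [[Hw Hs]|[/compatibleP[Hw Hs] /forallP Hx]].
  have Cg : compatible g.
    apply/compatibleP; split=> i j; rewrite -(ll i) -(ll j) -(sl i) -(sl j).
      exact: Hw.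
    exact: Hs.
  split=> //; apply/forallP => i.
  have le (k : 'I_d) : (g k <= x)%N by have := Hw (lift ord_max k) ord_max; rewrite sl sm ll; apply.
  case: ifP => // Dd.
  have d0 : (d.-1 < d)%N by rewrite prednK // (leq_ltn_trans _ (ltn_ord i)).
  have last : (g (Ordinal d0) < x)%N.
    have := Hs (lift ord_max (Ordinal d0)) ord_max; rewrite sl sm ll /=; apply=> //.
    by rewrite prednK // (leq_ltn_trans _ d0).
  apply: leq_ltn_trans last; case: (ltngtP i d.-1) => [lt||E].
  - by move/compatibleP: Cg => [Cw _]; apply: Cw.
  - by have := ltn_ord i; lia.
  - by rewrite (_ : i = Ordinal d0) //; apply: val_inj.
have Hle (i : 'I_d) : (g i <= x)%N by have := Hx i; case: ifP => // _ /ltnW.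
split=> i j; case: (unliftP ord_max i) => [i' ->|->]; case: (unliftP ord_max j) => [j' ->|->];
  rewrite ?sl ?sm ?ll //=.
- exact: Hw.
- by move=> lt; have := ltn_trans lt (ltn_ord j' : (j' < d)%N); rewrite ltnn.
- exact: Hs.
- by move=> E Dd; have := Hx i'; rewrite Dd.
- by move=> E; have := ltn_ord j' : (j' < d)%N; rewrite E ltnNge leqnSn.
- by move=> /n_Sn.
Qed.

(** The alphabet ['I_N] stays fixed and the bound [m] varies, so that the induction
    does not change the type of the words. *)
Lemma word_gfE d N m : (m < N)%N ->
  \sum_(f : {ffun 'I_d -> 'I_N} | compatible f && [forall i, (f i <= m)%N])
     \prod_i 'X^(m - f i) = word_gf d m.
Proof.
elim: d m => [|d IHd] m ltm.
  rewrite (big_pred1 [ffun i : 'I_0 => Ordinal ltm]) ?big_ord0 // => f.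
  rewrite [RHS](_ : _ = true); last by apply/eqP/ffunP => -[].
  apply/andP; split; last by apply/forallP => -[].
  by apply/forallP => -[].
rewrite (reindex (@snoc d N)); last exact/onW_bij/snoc_bij.
have E (p : {ffun 'I_d -> 'I_N} * 'I_N) :
    (compatible (snoc p) && [forall i, (snoc p i <= m)%N]) =
    (p.2 <= m)%N && (compatible p.1 &&
      [forall i : 'I_d, if D d then (p.1 i < p.2)%N else (p.1 i <= p.2)%N]).
  case: p => g x; rewrite compatible_snoc /=; apply/idP/idP.
    move=> /andP[-> /forallP/(_ ord_max)]; rewrite ffunE unlift_none /=.
    by move=> ->.
  move=> /andP[le /andP[-> Hx]]; rewrite Hx /=; apply/forallP => i.
  rewrite ffunE; case: unliftP => [j _|_] //=; apply: leq_trans le.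
  by move/forallP/(_ j): Hx; case: ifP => // _ /ltnW.
rewrite (eq_bigl _ _ E) -(pair_big_dep
   xpredT (fun (g : {ffun 'I_d -> 'I_N}) (x : 'I_N) => (x <= m)%N &&
      (compatible g && [forall i : 'I_d, if D d then (g i < x)%N else (g i <= x)%N]))
   (fun g x => \prod_i 'X^(m - snoc (g, x) i))) /=.
rewrite (exchange_big_dep (fun x : 'I_N => (x <= m)%N)) /=; last by move=> g x _ /andP[].
rewrite (big_ord_widen N (fun x => 'X^(d.+1 * (m - x)) *
    (if D d then (if x is x'.+1 then 'X^d * word_gf d x' else 0) else word_gf d x))) //.
apply: eq_big => [x|x lex]; first by rewrite ltnS.
(* Lowering the bound from m to y costs m - y for each of the d earlier letters. *)
have prodE (g : {ffun 'I_d -> 'I_N}) (y : nat) : (y <= m)%N ->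
    (forall i, (g i <= y)%N) ->
  \prod_(i < d.+1) 'X^(m - snoc (g, x) i) =
    'X^(m - x + d * (m - y)) * \prod_i 'X^(y - g i) :> {poly int}.
  move=> ley gy; rewrite big_ord_recr /= [X in _ * X = _](_ : _ = 'X^(m - x)); last first.
    by rewrite ffunE unlift_none.
  rewrite mulrC exprD -mulrA; congr (_ * _).
  rewrite mulnC exprM -[X in _ ^+ X](card_ord d) -prodr_const -big_split /=.
  apply: eq_bigr => i _; rewrite -exprD; congr ('X^_).
  have -> : snoc (g, x) (widen_ord (leqnSn d) i) = g i.
    rewrite ffunE (_ : widen_ord _ i = lift ord_max i) ?liftK //.
    by apply: val_inj; rewrite /= /bump leqNgt ltn_ord.
  by have := gy i; lia.
case: ifP => Dd.
  have d0 : (0 < d)%N by rewrite lt0n; apply: contraTneq Dd => ->.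
  case xE: (nat_of_ord x) => [|x'].
    rewrite mulr0 big_pred0 // => g; apply/negbTE/negP => /andP[_ /andP[_ /forallP]].
    by move/(_ (Ordinal d0)); rewrite ltn0.
  have lex' : (x' < m)%N by rewrite -xE.
  rewrite -(IHd x' (ltn_trans lex' ltm)) !mulr_sumr.
  apply: eq_big => [g|g /andP[_ /andP[_ /forallP Hx]]]; first by rewrite lex'.
  rewrite (prodE g x') ?(ltnW lex') //.
  by rewrite xE mulrA -exprD; congr ('X^_ * _); nia.
rewrite -(IHd x (ltn_ord x)) mulr_sumr.
apply: eq_big => [g|g /andP[_ /andP[_ /forallP Hx]]]; first by rewrite lex.
by rewrite (prodE g x).
Qed.

(** The sum over the last letter is a geometric convolution, and multiplying by
    the denominator isolates its term x = m. *)
Lemma word_gf_geom d :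
  fps_mul (word_gf d.+1) (fps_of_poly (1 - ('X^(d.+1) : {poly int})%:P * 'X)) =
  if D d then fps_mul (word_gf d) (fps_of_poly (('X^d : {poly int})%:P * 'X)) else word_gf d.
Proof.
apply/funext => m; rewrite fps_mul_geom.
have -> : (if D d then fps_mul (word_gf d) (fps_of_poly (('X^d : {poly int})%:P * 'X)) else word_gf d) m
   = if D d then (if m is x'.+1 then 'X^d * word_gf d x' else 0) else word_gf d m.
  by case: ifP => // _; rewrite fps_mul_polyXn.
rewrite [word_gf d.+1 m]/= big_ord_recr /= subnn muln0 expr0 mul1r addrAC.
case: m => [|m]; first by rewrite big_ord0 subr0 add0r.
rewrite -[RHS]add0r; congr (_ + _).
rewrite mulr_sumr -sumrB big1 // => x _.
rewrite mulrA -exprD -mulnS -subSn ?subrr // -ltnS; exact: ltn_ord.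
Qed.

(** Each step adds one factor to the denominator, and a factor [q^d t] to the
    numerator exactly when [d] is a descent. *)
Lemma word_gf_hilb d : fps_mul (word_gf d) (fps_of_poly (hilb_denominator d)) =
  fps_of_poly (('X^(\sum_(1 <= i < d | D i) i) : {poly int})%:P * 'X^(\sum_(1 <= i < d | D i) 1)).
Proof.
elim: d => [|d IHd].
  rewrite !big_geq // !expr0 mulr1 /hilb_denominator big_ord1 expr0.
  apply/funext => m; rewrite fps_mul_geom /fps_of_poly coefC.
  by case: m => [|m] /=; rewrite ?subr0 // mul1r subrr.
have -> : hilb_denominator d.+1 = (1 - ('X^(d.+1) : {poly int})%:P * 'X) * hilb_denominator d.
  by rewrite {1}/hilb_denominator big_ord_recr; apply: mulrC.
rewrite -fps_of_polyM fps_mulA word_gf_geom.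
have [d_0|dgt0] := posnP d.
  by rewrite d_0 (negPf D0) in IHd *; rewrite IHd !big_geq.
have recr (F : nat -> nat) : \sum_(1 <= i < d.+1 | D i) F i =
    (\sum_(1 <= i < d | D i) F i + if D d then F d else 0)%N.
  by rewrite big_mkcond big_nat_recr //= -big_mkcond.
rewrite !recr; case: (D d); last by rewrite !addn0.
rewrite -fps_mulA fps_of_polyM mulrC -fps_of_polyM fps_mulA IHd fps_of_polyM.
by congr fps_of_poly; rewrite !exprD polyCM mulrACA.
Qed.

End Words.

(** * Standardization of semistandard fillings *)

Section Standardization.
Variable lam : seq nat.
Hypothesis lam_sorted : sorted geq lam.
Local Notation box := 'I_(sumn lam).
Implicit Types (b c : box) (T : {perm box}).

Lemma is_SYTP T :
  reflect ((forall b c, box_row b = box_row c -> (box_col b < box_col c)%N ->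
              (T b < T c)%N) /\
           (forall b c, box_col b = box_col c -> (box_row b < box_row c)%N ->
              (T b < T c)%N))
          (is_SYT T).
Proof.
apply: (iffP forallP) => [H|[Hr Hc] b].
  split=> b c E lt; have /forallP/(_ c)/andP[/implyP h1 /implyP h2] := H b.
    by apply: h1; rewrite E eqxx.
  by apply: h2; rewrite E eqxx.
by apply/forallP => c; apply/andP; split; apply/implyP => /andP[/eqP E lt];
  [apply: Hr | apply: Hc].
Qed.

Lemma SYT_NW T b c : is_SYT T -> (box_row b <= box_row c)%N ->
  (box_col b <= box_col c)%N -> (T b <= T c)%N.
Proof.
move=> /is_SYTP[Hr Hc] ler lec.
have [a [ra ca]] := box_NW lam_sorted ler (leqnn (box_col c)).
apply: (@leq_trans (T a)).
  move: lec; rewrite leq_eqVlt -ca => /orP[/eqP E|lt].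
    by rewrite (box_inj (esym ra) E).
  by apply/ltnW/Hr.
move: ler; rewrite leq_eqVlt -ra => /orP[/eqP E|lt].
  by rewrite (box_inj E ca).
by apply/ltnW/Hc.
Qed.

Lemma is_descentP T (i j : box) : j = i.+1 :> nat ->
  is_descent T j = (box_row (T^-1 i)%g < box_row (T^-1 j)%g)%N.
Proof.
move=> ji; apply/existsP/idP => [[b /existsP[c /and3P[/eqP bE /eqP cE lt]]]|lt].
  have -> : i = T b by apply: val_inj; move: bE; rewrite /entry ji => -[].
  have -> : j = T c by apply: val_inj; move: cE; rewrite /entry => -[].
  by rewrite !permK.
exists (T^-1 i)%g; apply/existsP; exists (T^-1 j)%g.
by rewrite /entry !permKV lt ji !eqxx.
Qed.

Lemma is_descent0 T : ~~ is_descent T 0.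
Proof. by apply/existsP => -[b /existsP[c /and3P[]]]. Qed.

Section Order.
Variables (k : nat) (A : {ffun box -> 'I_k}).

(** Standardization numbers the boxes by increasing entries, and equal entries
    from left to right; in a semistandard filling they lie in distinct columns. *)
Definition std_lt b c : bool :=
  (A b < A c)%N || ((A b == A c) && (box_col b < box_col c)%N).

Lemma std_lt_trans : transitive std_lt.
Proof.
move=> c b a; rewrite /std_lt -!val_eqE /=.
by move=> /orP[l1|/andP[/eqP e1 l1]] /orP[l2|/andP[/eqP e2 l2]]; lia.
Qed.

Lemma std_lt_irr b : std_lt b b = false.
Proof. by rewrite /std_lt !ltnn andbF. Qed.

Lemma std_lt_total b c : is_SSYT A -> b != c -> std_lt b c || std_lt c b.
Proof.
move=> /is_SSYTP[_ Hc] nbc; rewrite /std_lt -!val_eqE /=.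
case: (ltngtP (A b) (A c)) => //= E; case: (ltngtP (box_col b) (box_col c)) => //= cE.
have [lt|lt|rE] := ltngtP (box_row b) (box_row c).
- by have := Hc _ _ cE lt; rewrite E ltnn.
- by have := Hc _ _ (esym cE) lt; rewrite E ltnn.
- by rewrite (box_inj rE cE) eqxx in nbc.
Qed.

Definition reading_word T : {ffun 'I_(sumn lam) -> 'I_k} := [ffun i => A (T^-1 i)%g].

Definition standardizes T : bool := is_SYT T && compatible (is_descent T) (reading_word T).

(** If two consecutive boxes in the order of [T] have equal entries, then [T] has
    no descent there, so the row does not go down; the column must then move to
    the right, or the second box would be North-West of the first. *)
Lemma standardizes_SSYT T : standardizes T ->
  is_SSYT A /\ (forall b c, (T b < T c)%N -> std_lt b c).
Proof.
case/andP=> ST /compatibleP[Hw Hs].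
have step (i j : box) : j = i.+1 :> nat -> A (T^-1 i)%g = A (T^-1 j)%g ->
    (box_col (T^-1 i)%g < box_col (T^-1 j)%g)%N.
  move=> ji E; rewrite ltnNge; apply/negP => lec.
  have [lt|ler] := ltnP (box_row (T^-1 i)%g) (box_row (T^-1 j)%g).
    by have := Hs i j ji; rewrite (is_descentP _ ji) lt !ffunE E ltnn => /(_ isT).
  by have := SYT_NW ST ler lec; rewrite !permKV ji ltnn.
(* The letters between two equal ones are equal to them, so the steps add up. *)
have chain n (i j : box) : j = (i + n).+1 :> nat -> A (T^-1 i)%g = A (T^-1 j)%g ->
    (box_col (T^-1 i)%g < box_col (T^-1 j)%g)%N.
  elim: n j => [|n IHn] j jE E; first by apply: step => //; rewrite jE addn0.
  have ltl : (i + n.+1 < sumn lam)%N by rewrite (leq_trans _ (ltn_ord j)) // jE.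
  pose l : box := Ordinal ltl.
  have lE : l = (i + n).+1 :> nat by rewrite /= addnS.
  have il : (A (T^-1 i)%g <= A (T^-1 l)%g)%N.
    by have := Hw i l; rewrite !ffunE; apply; rewrite lE ltnS leq_addr.
  have lj : (A (T^-1 l)%g <= A (T^-1 j)%g)%N.
    by have := Hw l j; rewrite !ffunE; apply; rewrite jE.
  have Eil : A (T^-1 i)%g = A (T^-1 l)%g.
    by apply/val_inj/eqP; rewrite /= eqn_leq il E lj.
  by apply: ltn_trans (IHn l lE Eil) _; apply: step; rewrite -?Eil // jE lE addnS.
have ord b c : (T b < T c)%N -> std_lt b c.
  move=> lt; have := Hw _ _ lt; rewrite !ffunE !permK leq_eqVlt /std_lt.
  case/orP=> [/eqP/val_inj E|->//]; rewrite E eqxx ltnn /=.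
  have := chain (T c - (T b).+1)%N (T b) (T c); rewrite !permK; apply=> //.
  by rewrite -addSn subnKC.
split=> //; apply/is_SSYTP; have [Hr Hc] := is_SYTP _ ST; split=> b c E lt.
  by have := ord _ _ (Hr _ _ E lt) => /orP[/ltnW//|/andP[/eqP->]].
have := ord _ _ (Hc _ _ E lt) => /orP[//|/andP[_]].
by rewrite E ltnn.
Qed.

(** At a descent, equal entries would put the second box below and to the right
    of the first, where a semistandard filling is strictly larger. *)
Lemma SSYT_standardizes T : is_SSYT A ->
  (forall b c, (T b < T c)%N -> std_lt b c) -> standardizes T.
Proof.
move=> SA ord; have [Hr Hc] := is_SSYTP _ SA.
have lt_std b c : std_lt b c -> (T b < T c)%N.
  move=> lt; rewrite ltnNge leq_eqVlt; apply/negP => /orP[/eqP/val_inj/perm_inj E|/ord lt'].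
    by rewrite E std_lt_irr in lt.
  by have := std_lt_trans lt lt'; rewrite std_lt_irr.
apply/andP; split.
  apply/is_SYTP; split=> b c E lt; apply: lt_std; rewrite /std_lt.
    have := Hr _ _ E lt; rewrite leq_eqVlt => /orP[/eqP/val_inj->|->//].
    by rewrite eqxx lt orbT.
  by rewrite (Hc _ _ E lt).
apply/compatibleP; split=> i j; rewrite !ffunE.
  move=> lt; have : (T (T^-1 i)%g < T (T^-1 j)%g)%N by rewrite !permKV.
  by move/ord/orP => [/ltnW//|/andP[/eqP->]].
move=> ji; rewrite (is_descentP _ ji) => ltr.
have : (T (T^-1 i)%g < T (T^-1 j)%g)%N by rewrite !permKV ji.
by move/ord/orP => [//|/andP[/eqP E /ltnW lec]]; apply: SSYT_NW.
Qed.

(** The standard tableaux counted are the numberings of the boxes along [std_lt],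
    a strict total order when [A] is semistandard; there is just one, which sends a
    box to the number [r] of its predecessors. *)
Lemma card_standardizes : #|[set T : {perm box} | standardizes T]| = is_SSYT A.
Proof.
have [SA|nS] := boolP (is_SSYT A); last first.
  apply/eqP; rewrite cards_eq0; apply/eqP/setP => T; rewrite !inE.
  by apply: contraNF nS => /standardizes_SSYT[].
pose r b := #|[set c | std_lt c b]|.
have r_lt b c : std_lt b c -> (r b < r c)%N.
  move=> lt; apply/proper_card/properP; split.
    by apply/subsetP => a; rewrite !inE => /std_lt_trans; apply.
  by exists b; rewrite inE ?std_lt_irr.
have r_bound b : (r b < sumn lam)%N.
  rewrite -[X in (_ < X)%N]card_ord -cardsT; apply/proper_card/properP; split; first exact: subsetT.
  by exists b; rewrite inE ?std_lt_irr.
pose R b : box := Ordinal (r_bound b).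
have R_inj : injective R.
  move=> b c [E]; apply/eqP; apply: contraT => /(std_lt_total SA)/orP[] /r_lt;
  by rewrite E ltnn.
have lt_R b c : (R b < R c)%N -> std_lt b c.
  move=> lt; have nbc : b != c by apply: contraTneq lt => ->; rewrite ltnn.
  case/orP: (std_lt_total SA nbc) => // /r_lt lt'.
  by have := ltn_trans lt lt'; rewrite ltnn.
rewrite (_ : [set T | _] = [set perm R_inj]) ?cards1 //.
apply/setP => T; rewrite !inE; apply/idP/eqP => [/standardizes_SSYT[_ ord]|->]; last first.
  by apply: SSYT_standardizes => // b c; rewrite !permE; apply: lt_R.
apply/permP => b; rewrite permE; apply: val_inj => /=.
have -> : r b = #|[set c | (T c < T b)%N]|.
  apply: eq_card => c; rewrite !inE; apply/idP/idP => [lt|]; last exact: ord.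
  rewrite ltnNge leq_eqVlt; apply/negP => /orP[/eqP/val_inj/perm_inj E|/ord lt'].
    by rewrite E std_lt_irr in lt.
  by have := std_lt_trans lt lt'; rewrite std_lt_irr.
have -> : [set c | (T c < T b)%N] = T @^-1: [set i : box | (i < T b)%N].
  by apply/setP => c; rewrite !inE.
rewrite card_preimset; last exact: perm_inj.
rewrite -sum1_card (eq_bigl (fun i : box => (i < T b)%N)) => [|i]; last by rewrite inE.
by rewrite -(big_ord_widen _ (fun _ => 1%N)) ?sum1_card ?card_ord // ltnW.
Qed.

End Order.

Local Open Scope ring_scope.

(** Count the pairs of a filling and a tableau that standardizes it, with either
    component first. *)
Lemma schur_poly_words (R : comNzRingType) k (x : 'I_k -> R) :
  schur_poly lam x = \sum_(T : {perm box} | is_SYT T)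
    \sum_(f : {ffun 'I_(sumn lam) -> 'I_k} | compatible (is_descent T) f) \prod_i x (f i).
Proof.
transitivity (\sum_(A : {ffun box -> 'I_k}) \sum_(T : {perm box} | standardizes A T) \prod_b x (A b)).
  rewrite /schur_poly big_mkcond; apply: eq_bigr => A _.
  rewrite sumr_const -[X in _ *+ X]/(#|fun T => standardizes A T|).
  have <- : #|[set T : {perm box} | standardizes A T]| = #|fun T => standardizes A T|.
    by apply: eq_card => T; rewrite inE.
  by rewrite card_standardizes; case: (is_SSYT A).
rewrite (exchange_big_dep (fun T : {perm box} => is_SYT T)) /=; last by move=> A T _ /andP[].
apply: eq_bigr => T ST.
pose refill_by (f : {ffun 'I_(sumn lam) -> 'I_k}) : {ffun box -> 'I_k} := [ffun b => f (T b)].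
have refill_byK f : reading_word (refill_by f) T = f by apply/ffunP => i; rewrite !ffunE permKV.
have refill_by_bij : bijective refill_by.
  exists (fun A => reading_word A T) => // A; apply/ffunP => b.
  by rewrite !ffunE permK.
rewrite (reindex refill_by) /=; last exact: onW_bij.
apply: eq_big => [f|f _]; first by rewrite /standardizes ST refill_byK.
rewrite [RHS](reindex_inj (@perm_inj _ T)) /=.
by apply: eq_bigr => b _; rewrite ffunE.
Qed.

Lemma schur_poly_rev_hilb :
  fps_mul (fun m => schur_poly lam (fun i : 'I_m.+1 => 'X^(m - i) : {poly int}))
    (fps_of_poly (hilb_denominator (sumn lam))) = fps_of_poly (syt_numerator lam).
Proof.
have E m : schur_poly lam (fun i : 'I_m.+1 => 'X^(m - i) : {poly int}) =
    \sum_(T : {perm box} | is_SYT T) word_gf (is_descent T) (sumn lam) m.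
  rewrite schur_poly_words; apply: eq_bigr => T _.
  rewrite -(@word_gfE _ (is_descent0 T) (sumn lam) m.+1 m) //; apply: eq_bigl => f.
  rewrite [X in _ = _ && X](_ : _ = true) ?andbT //.
  by apply/forallP => i; rewrite -ltnS.
apply/funext => n; rewrite /fps_mul; under eq_bigr do rewrite E mulr_suml.
rewrite exchange_big /= /syt_numerator /fps_of_poly coef_sum; apply: eq_bigr => T _.
exact: (congr1 (fun s => s n) (word_gf_hilb (is_descent0 T) (sumn lam))).
Qed.

End Standardization.

Theorem proposition3p14
    (K : closedFieldType) (charK : [pchar K]%R =i pred0)
    (U : vectType K) (dimU : \dim (fullv : {vspace U}) = 2)
    (e : 2.-tuple U) (basis_e : basis_of fullv e)
    (d : nat) (d_gt0 : 1 <= d)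
    (lam : seq nat) (lam_part : is_partition lam d) :
  M_hilbert lam e = schur_principal lam /\
  schur_principal lam =
    fps_div (fps_of_poly (syt_numerator lam))
            (fps_of_poly (hilb_denominator d)).
Proof.
have [lam_sorted _ /eqP <-] := and3P lam_part.
have H1 m := ch_schur_principal charK basis_e lam_sorted m.
split; first by apply/funext => m; apply: H1.
apply: fps_div_eq; first exact: hilb_denominator_unit.
rewrite -(schur_poly_rev_hilb lam_sorted); congr (fps_mul _ _).
by apply/funext => m; rewrite -H1; apply: ch_schur_principal_rev.
Qed.
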